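(* Let $M\in\widetilde{\mathcal A}$, $I\in\mathcal I_{\widetilde{\mathcal A}}$ and $P=\nu^{-1}(I)$. Assume that there exist nonzero morphisms $f\in\operatorname{Hom}_{\widetilde{\mathcal A}}(M,I)$ and $g\in\operatorname{Hom}_{\widetilde{\mathcal A}}(P,M)$ which are unique up to scalar, in the sense that $$\dim_{\operatorname{End}(I)}\operatorname{Hom}_{\widetilde{\mathcal A}}(M,I)=\dim_{\operatorname{End}(P)}\operatorname{Hom}_{\widetilde{\mathcal A}}(P,M)=1$$ (with the scalars taken in the division algebras $\operatorname{End}(I)\cong\operatorname{End}(P)$). Put $G=\operatorname{Ker}f$, $I'=\operatorname{Coker}f$, $P'=\operatorname{Ker}g$, $F=\operatorname{Coker}g$. Then the following equations hold in $\mathcal T_\Lambda$: $$X_{P[1]}X_M=q^{\frac12\Lambda(\mathbf m^\ast,\mathbf p^\ast)}\big(X_{F\oplus P'[1]}+q^{-\frac12\langle\mathbf i,\mathbf i\rangle}X_{G\oplus I'[-1]}\big)$$ and $$X_MX_{I[-1]}=q^{\frac12\Lambda(\mathbf i^\ast,\mathbf m^\ast)}\big(q^{-\frac12\langle\mathbf p,\mathbf p\rangle}X_{F\oplus P'[1]}+X_{G\oplus I'[-1]}\big).$$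
   Context: Let $k=\mathbb F_q$ be a finite field and $v=\sqrt q$ (so $q^{1/2}=v$). Let $Q$ be an acyclic valued quiver with vertex set $\{1,\dots,n\}$ and valuations $d_i\in\mathbb N^+$; let $m\ge n$ and let $\widetilde Q$ be a valued quiver obtained from $Q$ by attaching additional vertices $n+1,\dots,m$ with valuations $d_{n+1},\dots,d_m$. Let $\widetilde{\mathfrak S}$ be the $k$-species associated to $\widetilde Q$, identified with its tensor algebra (a finite dimensional hereditary $k$-algebra). $\widetilde{\mathcal A}$ is the category of finite dimensional left $\widetilde{\mathfrak S}$-modules, and $\mathcal P_{\widetilde{\mathcal A}}$, $\mathcal I_{\widetilde{\mathcal A}}$ are its subcategories of projective and injective objects. $S_i$ is the $i$-th simple module, $\mathcal D_i=\operatorname{End}(S_i)$, $\dim_k\mathcal D_i=d_i$. Define $m\times m$ matrices $R=(r_{ij})$, $R'=(r'_{ij})$ by $r_{ij}=\dim_{\mathcal D_i}\operatorname{Ext}^1_{\widetilde{\mathfrak S}}(S_j,S_i)$ and $r'_{ij}=\dim_{\mathcal D_i^{op}}\operatorname{Ext}^1_{\widetilde{\mathfrak S}}(S_i,S_j)$, and set $B=R'-R$, $E=I_m-R'$, $E'=I_m-R$, with $I_m$ the identity matrix. Standing assumption: $\Lambda$ is a skew-symmetric integral $m\times m$ matrix with $\Lambda(-B)=\operatorname{diag}(d_1,\dots,d_m)$. For $\alpha,\beta\in\mathbb Z^m$ (column vectors) write $\Lambda(\alpha,\beta)=\alpha^T\Lambda\beta$, ${}^\ast\alpha=E\alpha$,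 $\alpha^\ast=E'\alpha$. The dimension vector in $\mathbb Z^m$ of a module is denoted by the corresponding lowercase boldface letter ($\mathbf m$ for $M$, $\mathbf i$ for $I$, $\mathbf p$ for $P$, etc.). $\langle\cdot,\cdot\rangle$ is the Euler form on $\mathbb Z^m$: $\langle\mathbf x,\mathbf y\rangle=\dim_k\operatorname{Hom}_{\widetilde{\mathcal A}}(X,Y)-\dim_k\operatorname{Ext}^1_{\widetilde{\mathcal A}}(X,Y)$. $\nu:\mathcal P_{\widetilde{\mathcal A}}\to\mathcal I_{\widetilde{\mathcal A}}$ is the Nakayama functor. (Since $\widetilde{\mathcal A}$ is hereditary, $P'$ is projective and $I'$ is injective.) The quantum torus $\mathcal T_\Lambda$ is the $\mathbb Z[v,v^{-1}]$-algebra with basis $\{X^\alpha\mid\alpha\in\mathbb Z^m\}$ and multiplication $X^\alpha X^\beta=v^{\Lambda(\alpha,\beta)}X^{\alpha+\beta}$. For $M\in\widetilde{\mathcal A}$, $I\in\mathcal I_{\widetilde{\mathcal A}}$, $P\in\mathcal P_{\widetilde{\mathcal A}}$ (shifts taken in $D^b(\widetilde{\mathcal A})$), the quantum cluster character is $$X_{I[-1]\oplus M\oplus P[1]}=\sum_{\mathbf e}v^{\langle\mathbf p-\mathbf e,\mathbf m-\mathbf e-\mathbf i\rangle}|\mathrm{Gr}_{\mathbf e}M|\,X^{(\mathbf p-\mathbf e)^\ast-{}^\ast(\mathbf m-\mathbf e-\mathbf i)}\in\mathcal T_\Lambda,$$ where $\mathrm{Gr}_{\mathbf e}M$ is the set of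 submodules of $M$ with dimension vector $\mathbf e$; any of $I,M,P$ may be zero. *)

(* Defs.v *)
From HB Require Import structures.
From mathcomp Require Import all_boot all_order all_algebra all_field.
From mathcomp Require Import boolp classical_sets.
From mathcomp Require Import finmap monalg.

Set Implicit Arguments.
Unset Strict Implicit.
Unset Printing Implicit Defensive.

Import Order.TTheory GRing.Theory Num.Theory.

Local Open Scope ring_scope.

(* Dimension over a division algebra.  K is a space of scalars in D acting   *)
(* on W through act; w is a basis of the K-space Z / B when every z in Z is  *)
(* congruent modulo B to exactly one combination of w with scalars in K.     *)
(* Left and right actions are treated alike: a right action of K is a left   *)
(* action of the opposite algebra.                                           *)
Section DivisionDimension.
Variables (k : fieldType) (D W : vectType k) (K : {vspace D}).
Variables (act : D -> W -> W) (Z B : {vspace W}).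

Definition is_dbasis r (w : 'I_r -> W) : Prop :=
  (forall t, w t \in Z) /\
  (forall z, z \in Z -> exists! c : {ffun 'I_r -> D},
     (forall t, c t \in K) /\ z - \sum_t act (c t) (w t) \in B).

Definition ddim : nat :=
  xget 0%N (fun r => exists w : 'I_r -> W, is_dbasis w).
End DivisionDimension.

(* A valued quiver in the sense of Dlab and Ringel: vertex i has valuation   *)
(* d_i = vval i, and an arrow i -> j carries the pair                        *)
(* (varr1 i j, varr2 i j), with varr1 i j * d_i = varr2 i j * d_j; there is  *)
(* no arrow i -> j exactly when varr1 i j = 0.                               *)
Record vquiver (m : nat) := VQuiver {
  vval : 'I_m -> nat;
  varr1 : 'I_m -> 'I_m -> nat;
  varr2 : 'I_m -> 'I_m -> nat;
  vval_gt0 : forall i, (0 < vval i)%N;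
  varr_sym : forall i j, (varr1 i j * vval i = varr2 i j * vval j)%N
}.

Definition arrow m (Q : vquiver m) : rel 'I_m :=
  fun i j => varr1 Q i j != 0%N.

Definition acyclic m (Q : vquiver m) : Prop :=
  forall p : seq 'I_m, cycle (arrow Q) p -> p = [::].

Definition attaches_vertices n m (le_nm : (n <= m)%N)
    (Q : vquiver n) (Qt : vquiver m) : Prop :=
  let w := widen_ord le_nm in
  (forall i, vval Qt (w i) = vval Q i) /\
  (forall i j, varr1 Qt (w i) (w j) = varr1 Q i j /\
               varr2 Qt (w i) (w j) = varr2 Q i j).

(* The division algebras of a species over a finite field are commutative by *)
(* Wedderburn's theorem, hence field extensions of k.  The bimodule attached *)
(* to i -> j is a D_j-D_i-bimodule on which k acts centrally, so that a left *)
(* module V over the tensor algebra amounts to maps M_ij (x)_{D_i} V_i -> V_j. *)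
Record species (k : fieldType) m (Q : vquiver m) := Species {
  sD : 'I_m -> fieldExtType k;
  sM : 'I_m -> 'I_m -> vectType k;
  lactM : forall i j, sD j -> sM i j -> sM i j;
  ractM : forall i j, sM i j -> sD i -> sM i j;
  lactM_linl : forall i j x, linear (@lactM i j ^~ x);
  lactM_linr : forall i j c, linear (@lactM i j c);
  ractM_linl : forall i j c, linear (@ractM i j ^~ c);
  ractM_linr : forall i j x, linear (@ractM i j x);
  lactM1 : forall i j x, @lactM i j 1 x = x;
  ractM1 : forall i j x, @ractM i j x 1 = x;
  lactMM : forall i j c d x, @lactM i j (c * d) x = lactM c (lactM d x);
  ractMM : forall i j x c d, @ractM i j x (c * d) = ractM (ractM x c) d;
  lractM : forall i j c x d, ractM (@lactM i j c x) d = lactM c (ractM x d);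
  dim_sD : forall i, \dim {:sD i} = vval Q i;
  dim_sMr : forall i j,
    ddim {:sD i} (fun c x => @ractM i j x c) fullv 0 = varr1 Q i j;
  dim_sMl : forall i j,
    ddim {:sD j} (fun c x => @lactM i j c x) fullv 0 = varr2 Q i j
}.

Section TensorAlgebra.
Variables (k : fieldType) (m : nat) (Q : vquiver m) (S : species k Q).

(* An algebra morphism from S_0 = \prod_i D_i to C together with an          *)
(* S_0-bimodule morphism from \bigoplus_{i,j} M_ij to C.                     *)
Record species_map (C : algType k) := SpeciesMap {
  fD : forall i, {linear sD S i -> C};
  fM : forall i j, {linear sM S i j -> C};
  fDM : forall i x y, fD i (x * y) = fD i x * fD i y;
  fD0 : forall i j x y, i != j -> fD i x * fD j y = 0;
  fD1 : \sum_i fD i 1 = 1;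
  fM_l : forall i j c x, fM i j (lactM c x) = fD j c * fM i j x;
  fM_r : forall i j c x, fM i j (ractM x c) = fM i j x * fD i c
}.

Definition extends_map (A C : algType k) (u : species_map A)
    (w : species_map C) (phi : {lrmorphism A -> C}) : Prop :=
  (forall i x, phi (fD u i x) = fD w i x) /\
  (forall i j x, phi (fM u i j x) = fM w i j x).

(* The tensor algebra of S, given by its universal property.  It is required *)
(* to be finite dimensional, as it is for an acyclic quiver.                 *)
Record tensor_algebra := TensorAlgebra {
  talg :> falgType k;
  tmap : species_map talg;
  tmap_univ : forall (C : algType k) (w : species_map C),
    (exists phi : {lrmorphism talg -> C}, extends_map tmap w phi) /\
    (forall phi psi : {lrmorphism talg -> C},
       extends_map tmap w phi -> extends_map tmap w psi -> phi =1 psi)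
}.
End TensorAlgebra.

(* Finite dimensional left modules over a finite dimensional algebra.        *)
Record lmodA (k : fieldType) (A : falgType k) := LmodA {
  mcar :> vectType k;
  mact : {linear A -> 'End(mcar)};
  mact1 : mact 1 = \1%VF;
  mactM : forall a b, mact (a * b) = (mact a \o mact b)%VF
}.

Section Modules.
Variables (k : fieldType) (A : falgType k).
Implicit Types (M N P I : lmodA A).

Definition hom_defect M N (h : 'Hom(M, N)) : 'Hom(A, 'Hom(M, N)) :=
  linfun (fun a => (h \o mact M a)%VF - (mact N a \o h)%VF).

Definition homA M N : {vspace 'Hom(M, N)} := lker (linfun (@hom_defect M N)).

Fact hom_defect_linear1 M N (h : 'Hom(M, N)) :
  linear (fun a => (h \o mact M a)%VF - (mact N a \o h)%VF).
Proof.
move=> c a b; rewrite !linearP /= comp_lfunDr comp_lfunDl.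
by rewrite -comp_lfunZr -comp_lfunZl scalerBr opprD addrACA.
Qed.

Fact hom_defectE M N (h : 'Hom(M, N)) a :
  hom_defect h a = (h \o mact M a)%VF - (mact N a \o h)%VF.
Proof.
pose f := GRing.isLinear.Build _ _ _ _ _ (hom_defect_linear1 h).
pose F : {linear A -> 'Hom(M, N)} := HB.pack
  (fun a => (h \o mact M a)%VF - (mact N a \o h)%VF) f.
exact: (lfunE F a).
Qed.

Fact hom_defect_is_linear M N : linear (@hom_defect M N).
Proof.
move=> c g h; apply/lfunP => a; rewrite add_lfunE scale_lfunE !hom_defectE.
rewrite comp_lfunDr comp_lfunDl -comp_lfunZr -comp_lfunZl.
by rewrite scalerBr opprD addrACA.
Qed.
HB.instance Definition _ M N :=
  GRing.isLinear.Build _ _ _ _ (@hom_defect M N) (@hom_defect_is_linear M N).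

Lemma homAP M N (h : 'Hom(M, N)) :
  reflect (forall a x, h (mact M a x) = mact N a (h x)) (h \in homA M N).
Proof.
rewrite memv_ker lfunE /=; apply: (iffP eqP) => [h0 a x | hA].
  have /eqP := congr1 (fun f : 'Hom(A, 'Hom(M, N)) => f a x) h0.
  by rewrite hom_defectE !lfunE /= !lfunE /= !lfunE subr_eq0 => /eqP.
apply/lfunP => a; apply/lfunP => x.
by rewrite hom_defectE !lfunE /= !lfunE /= !lfunE /= hA subrr.
Qed.

Definition is_iso M N (h : 'Hom(M, N)) : Prop :=
  h \in homA M N /\
  exists2 h' : 'Hom(N, M), h' \in homA N M &
    (h' \o h = \1 /\ h \o h' = \1)%VF.

Definition isomorphic M N : Prop := exists h : 'Hom(M, N), is_iso h.

Definition submodule M (U : {vspace M}) : bool :=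
  `[< forall a x, x \in U -> mact M a x \in U >].

Definition is_simple M : Prop :=
  \dim {:M} <> 0%N /\
  forall U : {vspace M}, submodule U -> U = 0%VS \/ U = fullv.

Definition projective P : Prop :=
  forall M N (p : 'Hom(M, N)) (h : 'Hom(P, N)),
    p \in homA M N -> limg p = fullv -> h \in homA P N ->
    exists2 h' : 'Hom(P, M), h' \in homA P M & (p \o h')%VF = h.

Definition injective_mod I : Prop :=
  forall M N (u : 'Hom(M, N)) (h : 'Hom(M, I)),
    u \in homA M N -> lker u = 0%VS -> h \in homA M I ->
    exists2 h' : 'Hom(N, I), h' \in homA N I & (h' \o u)%VF = h.

(* G and C are the kernel and the cokernel of f, up to isomorphism.          *)
Definition is_ker M N (f : 'Hom(M, N)) (G : lmodA A) : Prop :=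
  exists u : 'Hom(G, M), [/\ u \in homA G M, lker u = 0%VS & limg u = lker f].

Definition is_coker M N (f : 'Hom(M, N)) (C : lmodA A) : Prop :=
  exists p : 'Hom(N, C), [/\ p \in homA N C, limg p = fullv & lker p = limg f].

Definition End_division M : Prop :=
  \dim {:M} <> 0%N /\
  forall h : 'End(M), h \in homA M M -> h != 0 -> is_iso h.

(* dim_{End(N)} Hom(M, N) and dim_{End(M)^op} Hom(M, N).                     *)
Definition hom_ldim M N : nat :=
  ddim (homA N N) (fun c (h : 'Hom(M, N)) => (c \o h)%VF) (homA M N) 0.
Definition hom_rdim M N : nat :=
  ddim (homA M M) (fun c (h : 'Hom(M, N)) => (h \o c)%VF) (homA M N) 0.

(* Ext^1(M, N) is the first cohomology of Hom_A(-, N) applied to the bar     *)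
(* resolution of M, i.e. of                                                  *)
(*   Hom_k(M, N) -> Hom_k(A (x) M, N) -> Hom_k(A (x) A (x) M, N).            *)
(* The kernel ext_Z consists of the delta : A -> Hom_k(M, N) such that       *)
(* delta(ab) = a delta(b) + delta(a) b, and the image ext_B of the h a - a h *)
(* with h in Hom_k(M, N).                                                    *)
Definition ext_d M N (dl : 'Hom(A, 'Hom(M, N))) :
    'Hom(A, 'Hom(A, 'Hom(M, N))) :=
  linfun (fun a => linfun (fun b =>
    (mact N a \o dl b)%VF - dl (a * b) + (dl a \o mact M b)%VF)).

Fact ext_d_linear2 M N (dl : 'Hom(A, 'Hom(M, N))) a :
  linear (fun b =>
    (mact N a \o dl b)%VF - dl (a * b) + (dl a \o mact M b)%VF).
Proof.
move=> c b b'; rewrite mulrDr -scalerAr !linearP /= !comp_lfunDr.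
by rewrite -!comp_lfunZr !scalerDr !addrA [LHS](ACl (1*3*5*2*4*6)).
Qed.

Fact ext_d_linear1 M N (dl : 'Hom(A, 'Hom(M, N))) :
  linear (fun a => linfun (fun b =>
    (mact N a \o dl b)%VF - dl (a * b) + (dl a \o mact M b)%VF)).
Proof.
move=> c a a'; apply/lfunP => b; rewrite add_lfunE scale_lfunE.
pose F a0 : {linear A -> 'Hom(M, N)} := HB.pack
  (fun b => (mact N a0 \o dl b)%VF - dl (a0 * b) + (dl a0 \o mact M b)%VF)
  (GRing.isLinear.Build _ _ _ _ _ (ext_d_linear2 dl a0)).
rewrite (lfunE (F _)) (lfunE (F a)) (lfunE (F a')) /=.
rewrite mulrDl -scalerAl !linearP /= !comp_lfunDl.
by rewrite -!comp_lfunZl !scalerDr !addrA [LHS](ACl (1*3*5*2*4*6)).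
Qed.

Fact ext_dE M N (dl : 'Hom(A, 'Hom(M, N))) a b : ext_d dl a b =
  (mact N a \o dl b)%VF - dl (a * b) + (dl a \o mact M b)%VF.
Proof.
pose F a0 : {linear A -> 'Hom(M, N)} := HB.pack
  (fun b => (mact N a0 \o dl b)%VF - dl (a0 * b) + (dl a0 \o mact M b)%VF)
  (GRing.isLinear.Build _ _ _ _ _ (ext_d_linear2 dl a0)).
pose G : {linear A -> 'Hom(A, 'Hom(M, N))} := HB.pack
  (fun a => linfun (fun b =>
    (mact N a \o dl b)%VF - dl (a * b) + (dl a \o mact M b)%VF))
  (GRing.isLinear.Build _ _ _ _ _ (ext_d_linear1 dl)).
by rewrite (lfunE G) (lfunE (F a)).
Qed.

Fact ext_d_is_linear M N : linear (@ext_d M N).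
Proof.
move=> c d d'; apply/lfunP => a; apply/lfunP => b.
rewrite add_lfunE scale_lfunE add_lfunE scale_lfunE !ext_dE.
rewrite !(add_lfunE, scale_lfunE) !comp_lfunDl !comp_lfunDr.
rewrite -!(comp_lfunZl, comp_lfunZr).
by rewrite !scalerDr scalerN opprD !addrA [LHS](ACl (1*3*5*2*4*6)).
Qed.
HB.instance Definition _ M N :=
  GRing.isLinear.Build _ _ _ _ (@ext_d M N) (@ext_d_is_linear M N).

Definition ext_Z M N : {vspace 'Hom(A, 'Hom(M, N))} := lker (linfun (@ext_d M N)).
Definition ext_B M N : {vspace 'Hom(A, 'Hom(M, N))} :=
  limg (linfun (@hom_defect M N)).

Lemma ext_ZP M N (dl : 'Hom(A, 'Hom(M, N))) :
  reflect (forall a b x, dl (a * b) x = mact N a (dl b x) + dl a (mact M b x))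
          (dl \in ext_Z M N).
Proof.
rewrite memv_ker lfunE /=; apply: (iffP eqP) => [d0 a b x | dM].
  have /eqP := congr1
    (fun f : 'Hom(A, 'Hom(A, 'Hom(M, N))) => f a b x) d0.
  rewrite ext_dE !(add_lfunE, opp_lfunE, comp_lfunE, zero_lfunE).
  by rewrite addrAC subr_eq0 => /eqP.
apply/lfunP => a; apply/lfunP => b; apply/lfunP => x.
rewrite ext_dE !(add_lfunE, opp_lfunE, comp_lfunE, zero_lfunE) dM.
by rewrite addrAC subrr.
Qed.

Lemma ext_BP M N (dl : 'Hom(A, 'Hom(M, N))) :
  reflect (exists h : 'Hom(M, N),
             forall a x, dl a x = h (mact M a x) - mact N a (h x))
          (dl \in ext_B M N).
Proof.
apply: (iffP memv_imgP) => [[h _ ->] | [h dlE]]; exists h.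
- by move=> a x; rewrite !lfunE /= hom_defectE !(add_lfunE, opp_lfunE, comp_lfunE).
- exact: memvf.
- apply/lfunP => a; apply/lfunP => x; rewrite lfunE /= hom_defectE dlE.
  by rewrite !(add_lfunE, opp_lfunE, comp_lfunE).
Qed.

Lemma ext_B_sub M N : (ext_B M N <= ext_Z M N)%VS.
Proof.
apply/subvP => dl /ext_BP[h dlE]; apply/ext_ZP => a b x.
by rewrite !dlE !mactM !comp_lfunE linearB /= [RHS]addrC addrA subrK.
Qed.

Definition hom_dim M N : nat := \dim (homA M N).
Definition ext_dim M N : nat := (\dim (ext_Z M N) - \dim (ext_B M N))%N.

(* dim_{End(N)} Ext^1(M, N) and dim_{End(M)^op} Ext^1(M, N).                 *)
Definition ext_ldim M N : nat :=
  ddim (homA N N)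
    (fun c (dl : 'Hom(A, 'Hom(M, N))) => linfun (fun a => (c \o dl a)%VF))
    (ext_Z M N) (ext_B M N).
Definition ext_rdim M N : nat :=
  ddim (homA M M)
    (fun c (dl : 'Hom(A, 'Hom(M, N))) => linfun (fun a => (dl a \o c)%VF))
    (ext_Z M N) (ext_B M N).

Definition zero_lmodA : lmodA A.
Proof.
pose z : {linear A -> 'End('rV[k]_0)} := \0.
apply: (@LmodA k A 'rV[k]_0 z).
- by apply/lfunP => x; rewrite !thinmx0.
- by move=> a b; apply/lfunP => x; rewrite !thinmx0.
Defined.

Definition reg_lmodA : lmodA A.
Proof.
apply: (@LmodA k A A (@amull k A)).
- exact: amull1.
- by move=> a b; apply/lfunP => x; rewrite comp_lfunE !lfunE /= mulrA.
Defined.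

(* The right A-module Hom_A(P, A): (h . a)(x) = h(x) a.                      *)
Definition dual_ract P (a : A) : 'End(subvs_of (homA P reg_lmodA)) :=
  linfun (fun h => vsproj (homA P reg_lmodA)
                     (amulr a \o (vsval h : 'Hom(P, reg_lmodA)))%VF).

Fact dual_ractE P a h x :
  (vsval (dual_ract P a h) : 'Hom(P, reg_lmodA)) x =
  (vsval h : 'Hom(P, reg_lmodA)) x * a :> A.
Proof.
pose f (h : subvs_of (homA P reg_lmodA)) := vsproj (homA P reg_lmodA)
                     (amulr a \o (vsval h : 'Hom(P, reg_lmodA)))%VF.
have lin_f : linear f.
  move=> c g g'; rewrite /f !linearP /= comp_lfunDr -comp_lfunZr.
  by rewrite linearP.
pose F : {linear subvs_of (homA P reg_lmodA) -> subvs_of (homA P reg_lmodA)} :=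
  HB.pack f (GRing.isLinear.Build _ _ _ _ f lin_f).
rewrite (lfunE F) /= /f vsprojK ?comp_lfunE ?lfunE //.
apply/(homAP (M := P) (N := reg_lmodA)) => b y.
have /(homAP (M := P) (N := reg_lmodA)) hA := subvsP h.
by rewrite !comp_lfunE hA /= !lfunE /= mulrA.
Qed.

(* The Nakayama functor on objects: nu(P) = Hom_k(Hom_A(P, A), k), with      *)
(* (a xi)(h) = xi(h . a).                                                    *)
Definition nakayama_act P (a : A) :
    'End('Hom(subvs_of (homA P reg_lmodA), k^o)) :=
  linfun (fun xi : 'Hom(subvs_of (homA P reg_lmodA), k^o) =>
            (xi \o dual_ract P a)%VF).

Fact nakayama_actE P a xi h :
  nakayama_act P a xi h = xi (dual_ract P a h).
Proof.
pose V := subvs_of (homA P reg_lmodA).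
pose f (xi : 'Hom(V, k^o)) := (xi \o dual_ract P a)%VF.
have lin_f : linear f by move=> c g g'; rewrite /f comp_lfunDl -comp_lfunZl.
pose F : {linear 'Hom(V, k^o) -> 'Hom(V, k^o)} :=
  HB.pack f (GRing.isLinear.Build _ _ _ _ f lin_f).
by rewrite (lfunE F) /= /f comp_lfunE.
Qed.

Fact dual_ract_linear P : linear (dual_ract P).
Proof.
move=> c a b; apply/lfunP => h; apply/val_inj/lfunP => x.
rewrite /= add_lfunE scale_lfunE dual_ractE linearP /= add_lfunE scale_lfunE.
by rewrite !dual_ractE mulrDr scalerAr.
Qed.

Fact nakayama_act_linear P : linear (nakayama_act P).
Proof.
move=> c a b; apply/lfunP => xi; apply/lfunP => h.
rewrite nakayama_actE dual_ract_linear !(add_lfunE, scale_lfunE) linearP /=.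
by rewrite !nakayama_actE.
Qed.
HB.instance Definition _ P :=
  GRing.isLinear.Build _ _ _ _ (nakayama_act P) (@nakayama_act_linear P).

Definition nakayama P : lmodA A.
Proof.
apply: (@LmodA k A 'Hom(subvs_of (homA P reg_lmodA), k^o) (nakayama_act P)).
- apply/lfunP => xi; apply/lfunP => h; rewrite /= nakayama_actE id_lfunE.
  congr (xi _); apply/val_inj/lfunP => x.
  by rewrite /= dual_ractE mulr1.
- move=> a b; apply/lfunP => xi; apply/lfunP => h.
  rewrite /= comp_lfunE !nakayama_actE; congr (xi _).
  by apply/val_inj/lfunP => x; rewrite /= !dual_ractE mulrA.
Defined.
End Modules.

Section VspaceFinite.
Import VectorInternalTheory.
Variables (k : finFieldType) (V : vectType k).
HB.instance Definition _ := [Countable of {vspace V} by <:].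
HB.instance Definition _ := [Finite of {vspace V} by <:].
End VspaceFinite.

(* The ring Z[v, v^-1], v = sqrt q with q = #|k|, as a subring of algC.      *)
Section LaurentRing.
Variable k : finFieldType.

Definition vC : algC := sqrtC #|k|%:R.

Definition laurent_pred : {pred algC} := fun z =>
  `[< exists (p : {poly int}) (N : nat),
        z = (map_poly intr p).[vC] / vC ^+ N >].

Fact vC_neq0 : vC != 0.
Proof.
rewrite sqrtC_eq0 pnatr_eq0 -lt0n; apply/card_gt0P; by exists 0.
Qed.

Fact laurent_subring : subring_closed laurent_pred.
Proof.
split.
- by apply/asboolP; exists 1, 0%N; rewrite rmorph1 hornerC expr0 divr1.
- move=> x y /asboolP[p [N ->]] /asboolP[r [K ->]]; apply/asboolP.
  exists (p * 'X^K - r * 'X^N), (N + K)%N.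
  rewrite rmorphB !rmorphM /= !map_polyXn !hornerE exprD.
  have [vN vK] : vC ^+ N != 0 /\ vC ^+ K != 0 by rewrite !expf_neq0 ?vC_neq0.
  rewrite mulrBl -mulf_div divff // mulr1; congr (_ - _).
  by rewrite [vC ^+ N * _]mulrC -mulf_div divff ?mulr1.
- move=> x y /asboolP[p [N ->]] /asboolP[r [K ->]]; apply/asboolP.
  exists (p * r), (N + K)%N.
  by rewrite rmorphM hornerM exprD invfM mulrACA.
Qed.

Fact laurent_vpow (z : int) : vC ^ z \in laurent_pred.
Proof.
case: z => n; apply/asboolP.
  by exists 'X^n, 0%N; rewrite map_polyXn hornerXn expr0 divr1.
by exists 1, n.+1; rewrite rmorph1 hornerC mul1r.
Qed.

HB.instance Definition _ :=
  GRing.isSubringClosed.Build algC laurent_pred laurent_subring.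

Record laurent := Laurent { laurent_val : algC; _ : laurent_val \in laurent_pred }.
HB.instance Definition _ := [isSub for laurent_val].
HB.instance Definition _ := [Choice of laurent by <:].
HB.instance Definition _ := [SubChoice_isSubComNzRing of laurent by <:].

Definition vpow (z : int) : laurent := Laurent (laurent_vpow z).

Fact vpow0 : vpow 0 = 1.
Proof. exact/val_inj. Qed.

Fact vpowD y z : vpow (y + z) = vpow y * vpow z.
Proof. by apply/val_inj; rewrite /= expfzDr ?vC_neq0. Qed.
End LaurentRing.

(* The algebra with basis (<< a >>)_{a in K} over R and product              *)
(* << a >> << b >> = w a b *: << a + b >>.                                   *)
Section TwistedProduct.
Variables (R : comNzRingType) (K : zmodType) (w : K -> K -> R).
Hypotheses (w0l : forall a, w 0 a = 1) (w0r : forall a, w a 0 = 1).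
Hypothesis w_cocycle :
  forall a b c, w a (b + c) * w b c = w a b * w (a + b) c.

Local Notation T := {malg R[K]}.

Local Notation "x *M_[ a , b ] y" := << x@_a * y@_b * w a b *g a + b >>
  (at level 40, no associativity, format "x  *M_[ a ,  b ]  y").

Definition twmul (x y : T) : T :=
  \sum_(a <- msupp x) \sum_(b <- msupp y) x *M_[a, b] y.

Fact scale_malgU c d a : c *: (<< d *g a >> : T) = << c * d *g a >>.
Proof. by apply/malgP => b; rewrite mcoeffZ !mcoeffU mulrnAr. Qed.

Fact twmulr x y :
  twmul x y = \sum_(b <- msupp y) \sum_(a <- msupp x) x *M_[a, b] y.
Proof. by rewrite /twmul exchange_big. Qed.

Fact twmullw (d1 d2 : {fset K}) x y :
  (msupp x `<=` d1)%fset -> (msupp y `<=` d2)%fset ->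
  twmul x y = \sum_(a <- d1) \sum_(b <- d2) x *M_[a, b] y.
Proof.
move=> le_d1 le_d2; rewrite /twmul (big_fset_incl _ le_d1) /=.
  apply/eq_bigr=> a _; apply/big_fset_incl => // b _ /mcoeff_outdom ->.
  by rewrite mulr0 mul0r monalgU0.
move=> a _ /mcoeff_outdom xa.
by rewrite big1 => // b _; rewrite xa !mul0r monalgU0.
Qed.

Fact twmulrw (d1 d2 : {fset K}) x y :
  (msupp x `<=` d1)%fset -> (msupp y `<=` d2)%fset ->
  twmul x y = \sum_(b <- d2) \sum_(a <- d1) x *M_[a, b] y.
Proof. by move=> le_d1 le_d2; rewrite (twmullw le_d1 le_d2) exchange_big. Qed.

Fact twmul0x : left_zero 0 twmul.
Proof. by move=> x; rewrite /twmul msupp0 big_seq_fset0. Qed.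

Fact twmulx0 : right_zero 0 twmul.
Proof. by move=> x; rewrite twmulr msupp0 big_seq_fset0. Qed.

Fact twmulUx c a x : twmul << c *g a >> x =
  \sum_(b <- msupp x) << c * x@_b * w a b *g a + b >>.
Proof.
rewrite (twmullw msuppU_le (fsubset_refl _)) big_seq_fset1.
by apply/eq_bigr => b _; rewrite mcoeffUU.
Qed.

Fact twmulxU c a x : twmul x << c *g a >> =
  \sum_(b <- msupp x) << x@_b * c * w b a *g b + a >>.
Proof.
rewrite (twmulrw (fsubset_refl _) msuppU_le) big_seq_fset1.
by apply/eq_bigr => b _; rewrite mcoeffUU.
Qed.

Fact twmulUU c1 c2 a1 a2 : twmul << c1 *g a1 >> << c2 *g a2 >> =
  << c1 * c2 * w a1 a2 *g a1 + a2 >>.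
Proof. by rewrite (twmulrw msuppU_le msuppU_le) !big_seq_fset1 !mcoeffUU. Qed.

Fact twmulEl x y : twmul x y = \sum_(a <- msupp x) twmul << x@_a *g a >> y.
Proof. by apply/eq_bigr=> a _; rewrite twmulUx. Qed.

Fact twmulEr x y : twmul x y = \sum_(b <- msupp y) twmul x << y@_b *g b >>.
Proof. by rewrite twmulr; apply/eq_bigr=> b _; rewrite twmulxU. Qed.

Fact twmulDl : left_distributive twmul +%R.
Proof.
move=> x y z.
rewrite [in RHS](twmullw (fsubsetUl _ (msupp y)) (fsubset_refl _)).
rewrite [in RHS](twmullw (fsubsetUr (msupp x) _) (fsubset_refl _)).
rewrite (twmullw (msuppD_le _ _) (fsubset_refl _)).
rewrite -big_split /=; apply/eq_bigr=> a _.
rewrite -big_split /=; apply/eq_bigr=> b _.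
by rewrite mcoeffD !mulrDl monalgUD.
Qed.

Fact twmulDr : right_distributive twmul +%R.
Proof.
move=> z x y.
rewrite [in RHS](twmulrw (fsubset_refl _) (fsubsetUl _ (msupp y))).
rewrite [in RHS](twmulrw (fsubset_refl _) (fsubsetUr (msupp x) _)).
rewrite (twmulrw (fsubset_refl _) (msuppD_le _ _)).
rewrite -big_split /=; apply/eq_bigr=> a _.
rewrite -big_split /=; apply/eq_bigr=> b _.
by rewrite mcoeffD mulrDr mulrDl monalgUD.
Qed.

Fact twmulA : associative twmul.
Proof.
move=> x y z.
rewrite [RHS](big_morph (twmul^~ _) (fun _ _ => twmulDl _ _ _) (twmul0x _)).
rewrite twmulEl; apply/eq_bigr=> a _.
rewrite [LHS](big_morph (twmul _) (fun _ _ => twmulDr _ _ _) (twmulx0 _)).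
rewrite [RHS](big_morph (twmul^~ _) (fun _ _ => twmulDl _ _ _) (twmul0x _)).
apply/eq_bigr=> b _.
rewrite [LHS](big_morph (twmul _) (fun _ _ => twmulDr _ _ _) (twmulx0 _)).
rewrite twmulEr; apply/eq_bigr=> c _; rewrite !twmulUU addrA.
congr (<< _ *g _ >>); rewrite -!mulrA; congr (_ * (_ * _)).
by rewrite [w b c * _]mulrC w_cocycle mulrCA.
Qed.

Fact twmul1x : left_id << 1 *g 0 >> twmul.
Proof.
move=> x; rewrite twmulUx [RHS]monalgE; apply/eq_bigr=> a _.
by rewrite w0l mul1r mulr1 add0r.
Qed.

Fact twmulx1 : right_id << 1 *g 0 >> twmul.
Proof.
move=> x; rewrite twmulxU [RHS]monalgE; apply/eq_bigr=> a _.
by rewrite w0r !mulr1 addr0.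
Qed.

Fact malgU0_neq0 : << 1 *g 0 >> != 0 :> T.
Proof. by rewrite monalgU_eq0 oner_eq0. Qed.

Fact twscaleAl c x y : c *: twmul x y = twmul (c *: x) y.
Proof.
rewrite [in RHS](twmullw (msuppZ_le c x) (fsubset_refl _)).
rewrite /twmul scaler_sumr; apply/eq_bigr=> a _.
rewrite scaler_sumr; apply/eq_bigr=> b _.
by rewrite scale_malgU mcoeffZ !mulrA.
Qed.

Fact twscaleAr c x y : c *: twmul x y = twmul x (c *: y).
Proof.
rewrite [in RHS](twmullw (fsubset_refl _) (msuppZ_le c y)).
rewrite /twmul scaler_sumr; apply/eq_bigr=> a _.
rewrite scaler_sumr; apply/eq_bigr=> b _.
by rewrite scale_malgU mcoeffZ !mulrA [c * _]mulrC.
Qed.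
End TwistedProduct.

Definition lam m (L : 'M[int]_m) (a b : 'cV[int]_m) : int :=
  (a^T *m L *m b) 0 0.

(* The quantum torus, with product X^a X^b = v^{L(a, b)} X^{a + b}.          *)
Definition qtorus (k : finFieldType) m (L : 'M[int]_m) : Type :=
  {malg (laurent k)['cV[int]_m]}.

Section QuantumTorus.
Variables (k : finFieldType) (m : nat) (L : 'M[int]_m).

Definition qtwist (a b : 'cV[int]_m) : laurent k := vpow k (lam L a b).

Fact lamDl a b c : lam L (a + b) c = lam L a c + lam L b c.
Proof. by rewrite /lam (raddfD trmx) !mulmxDl mxE. Qed.

Fact lamDr a b c : lam L a (b + c) = lam L a b + lam L a c.
Proof. by rewrite /lam mulmxDr mxE. Qed.

Fact qtwist0l a : qtwist 0 a = 1.
Proof. by rewrite /qtwist /lam trmx0 !mul0mx mxE vpow0. Qed.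

Fact qtwist0r a : qtwist a 0 = 1.
Proof. by rewrite /qtwist /lam mulmx0 mxE vpow0. Qed.

Fact qtwist_cocycle a b c :
  qtwist a (b + c) * qtwist b c = qtwist a b * qtwist (a + b) c.
Proof.
rewrite /qtwist -!vpowD lamDl lamDr; congr vpow.
by rewrite addrA.
Qed.

HB.instance Definition _ :=
  GRing.Lmodule.copy (qtorus k L) {malg (laurent k)['cV[int]_m]}.
HB.instance Definition _ := GRing.Zmodule_isNzRing.Build (qtorus k L)
  (twmulA qtwist_cocycle) (twmul1x qtwist0l) (twmulx1 qtwist0r)
  (twmulDl qtwist) (twmulDr qtwist) (malgU0_neq0 _ _).
HB.instance Definition _ := GRing.Lmodule_isLalgebra.Build (laurent k)
  (qtorus k L) (twscaleAl qtwist).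
HB.instance Definition _ := GRing.Lalgebra_isAlgebra.Build (laurent k)
  (qtorus k L) (twscaleAr qtwist).

Definition qX (a : 'cV[int]_m) : qtorus k L := << 1 *g a >>.

Lemma qX_mul a b : qX a * qX b = vpow k (lam L a b) *: qX (a + b).
Proof.
apply: etrans (twmulUU qtwist 1 1 a b) _.
by apply: etrans (esym (scale_malgU _ _ _)); rewrite !mul1r mulr1.
Qed.
End QuantumTorus.

Section Character.
Variables (k : finFieldType) (m : nat) (Q : vquiver m) (Sp : species k Q).
Variable (T : tensor_algebra Sp).
Implicit Types (M N P I : lmodA T).

(* Dimension vectors: entry i is the dimension over D_i of e_i U, where e_i  *)
(* is the idempotent of vertex i and U is a submodule of M.                  *)
Definition dimvec_sub M (U : {vspace M}) : 'cV[int]_m :=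
  \col_i (ddim {:sD Sp i} (fun c x => mact M (fD (tmap T) i c) x)
            (mact M (fD (tmap T) i 1) @: U)%VS 0)%:Z.

Definition dimvec M : 'cV[int]_m := dimvec_sub (fullv : {vspace M}).

(* S_i, up to isomorphism.                                                   *)
Definition simple_at (i : 'I_m) M : Prop :=
  is_simple M /\ mact M (fD (tmap T) i 1) != 0.

Definition nb_sub M (e : 'cV[int]_m) : nat :=
  #|[set U : {vspace M} | submodule U & dimvec_sub U == e]|.

(* The Gram matrix of the Euler form: the bilinear form on Z^m with          *)
(* <dimvec X, dimvec Y> = dim Hom(X, Y) - dim Ext^1(X, Y) for all X and Y.   *)
Definition euler_gram : 'M[int]_m :=
  xget 0 (fun C : 'M[int]_m => forall X Y : lmodA T,
    ((dimvec X)^T *m C *m dimvec Y) 0 0 = (hom_dim X Y)%:Z - (ext_dim X Y)%:Z).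

Definition euler (x y : 'cV[int]_m) : int := (x^T *m euler_gram *m y) 0 0.

Section Matrices.
Variable S : 'I_m -> lmodA T.

Definition Rmx : 'M[int]_m := \matrix_(i, j) (ext_ldim (S j) (S i))%:Z.
Definition Rmx' : 'M[int]_m := \matrix_(i, j) (ext_rdim (S i) (S j))%:Z.
Definition Bmx : 'M[int]_m := Rmx' - Rmx.
Definition Emx : 'M[int]_m := 1%:M - Rmx'.
Definition Emx' : 'M[int]_m := 1%:M - Rmx.

Definition lstar (a : 'cV[int]_m) : 'cV[int]_m := Emx *m a.
Definition rstar (a : 'cV[int]_m) : 'cV[int]_m := Emx' *m a.

(* The quantum cluster character of I[-1] (+) M (+) P[1].  Dimension vectors *)
(* of submodules of M have entries between 0 and dim_k M, so the sum over    *)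
(* all e in Z^m reduces to these.                                            *)
Definition qchar (L : 'M[int]_m) I M P : qtorus k L :=
  \sum_(e0 : 'cV['I_(\dim {:M}).+1]_m)
    let e := map_mx (fun t => (nat_of_ord t)%:Z) e0 in
    ((nb_sub M e)%:R * vpow k (euler (dimvec P - e) (dimvec M - e - dimvec I))) *:
      qX k L (rstar (dimvec P - e) - lstar (dimvec M - e - dimvec I)).
End Matrices.
End Character.

(* Main.v *)
(* Every submodule U of M either contains Im g or is contained in Ker f, and   *)
(* exactly one of the two holds.  Indeed Hom(P, U) is 0 or all of Hom(P, M),   *)
(* the latter exactly when Im g <= U; Hom(U, I) is 0 exactly when U <= Ker f;  *)
(* and dim Hom(P, U) = dim Hom(U, I) since I = nu P.  The submodules           *)
(* containing Im g are those of F, the ones inside Ker f are those of G, so    *)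
(* the sum defining X_M splits into the sums defining the two characters on    *)
(* the right.  The powers of v match because p^* = *i, because                 *)
(* <p, u> = <u, i> is dim Hom(P, P) or 0 accordingly, and because Lambda (-B)  *)
(* is the diagonal matrix of the valuations.                                   *)
(*   That the Euler form is bilinear in dimension vectors is read off from the *)
(* tensor algebra: Ext^1(X, Y) is the space of derivations into Hom_k(X, Y)    *)
(* modulo the inner ones.  Derivations are inner on the separable subalgebra   *)
(* of the vertices, and by the universal property those vanishing there are    *)
(* the bimodule maps on the arrows, which are counted by means of bases.       *)

From HB Require Import structures.
Require Import Defs.
From mathcomp Require Import all_boot all_order all_algebra all_field.
From mathcomp Require Import boolp classical_sets zify ring.

Set Implicit Arguments.
Unset Strict Implicit.
Unset Printing Implicit Defensive.

Import Order.TTheory GRing.Theory Num.Theory.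
Local Open Scope ring_scope.

(** * Dimension over a division algebra *)

(** Counting submodules one by one instead of by dimension vector ([qcharE]) turns every character
    into a sum over subspaces that are submodules. Let U be a submodule of M with dimension vector
    e. Multiplying its term in X_M on the left by X_{P[1]} gives the scalar power of v common to the
    whole formula, times v^{-<p,m-e>}, times a [middle_term] depending only on p, m and e;
    multiplying on the right by X_{I[-1]} gives the same with v^{-<e,i>} ([qX_mul_qterm],
    [qterm_mul_qX]). Three facts produce this: Lambda takes the value -<x,y> on [rst x] and By
    ([lam_rstarl]); [lst x] is [rst x] minus Bx ([lstarE]); and [rst p = lst i] ([nakayama_star]),
    because <p,s> = dim Hom(P,S) = dim Hom(S,I) = <s,i> for every simple S.

    The submodules split into two classes ([submodule_dichotomy]). Since Hom(P,M) is spanned by g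
    over End(P), Hom(P,U) has the dimension d of End(P) when Im g lies in U, and vanishes otherwise.
    Since I is injective and Hom(M,I) is spanned by f over End(I), Hom(U,I) vanishes exactly when U
    lies in Ker f. The two spaces have the same dimension because I is the Nakayama image of P, so
    exactly one of the two inclusions holds. If Im g lies in U, then <p,e> = <p,m> = d and the
    middle term is the term of U/Im g in X_{F+P'[1]} ([qchar_coker], [qterm_above]). If U lies in
    Ker f, then <p,e> = 0 and the middle term is the term of U in X_{G+I'[-1]} ([qchar_ker],
    [qterm_below]). As <p,e> = <e,i> and <p,p> = <i,i> = d, the remaining powers of v are those of
    the two formulas.

    The supporting theory makes the Euler form computable: it is bilinear in dimension vectors
    ([euler_gramP]), it reduces to Hom against projectives and injectives ([ext_projective],
    [ext_injective]), Hom into the Nakayama image has the expected dimension ([nakayama_hom_dim]),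
    and its Gram matrix, read on the simples, is both E'^T D and D E with D the diagonal of
    valuations ([euler_gram_Emx'], [euler_gram_Emx]). *)

Section LinearAlgebra.
Variable k : fieldType.

Lemma linfunE (V W : vectType k) (f : V -> W) : linear f -> linfun f =1 f.
Proof.
move=> lf; pose F : {linear V -> W} :=
  HB.pack f (GRing.isLinear.Build _ _ _ _ f lf).
exact: (lfunE F).
Qed.

Lemma dim_bij (V W : vectType k) (f : V -> W) (U : {vspace V}) (U' : {vspace W}) :
    linear f -> (forall u, u \in U -> f u \in U') ->
    (forall u, u \in U -> f u = 0 -> u = 0) ->
    (forall w, w \in U' -> exists2 u, u \in U & f u = w) ->
  \dim U = \dim U'.
Proof.
move=> lf fU f0 fonto; have <- : (linfun f @: U)%VS = U'.
  apply/vspaceP => w; apply/memv_imgP/idP => [[u uU ->]|/fonto[u uU <-]].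
    by rewrite linfunE // fU.
  by exists u; rewrite ?linfunE.
apply/esym/limg_dim_eq/eqP; rewrite -subv0; apply/subvP => u.
rewrite memv_cap memv_ker memv0 linfunE // => /andP[uU /eqP fu].
exact/eqP/f0.
Qed.

(** Among the subspaces inside [p], one of maximal dimension absorbs every vector of [p], since
    adjoining such a vector stays inside [p]. *)
Lemma vspace_of_pred (V : vectType k) (p : V -> Prop) :
    p 0 -> (forall c x y, p x -> p y -> p (c *: x + y)) ->
  exists U : {vspace V}, forall x, x \in U <-> p x.
Proof.
move=> p0 p_lin.
pose q n := `[< exists2 U : {vspace V}, \dim U = n & forall x, x \in U -> p x >].
have exq : exists n, q n.
  exists 0%N; apply/asboolP; exists 0%VS; first exact: dimv0.
  by move=> x; rewrite memv0 => /eqP->.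
have ubq n : q n -> (n <= \dim {:V})%N.
  by move/asboolP => [U <- _]; apply/dimvS/subvf.
have [n /asboolP[U dU pU] maxU] := ex_maxnP exq ubq.
exists U => x; split; first exact: pU.
move=> px; have : (\dim (U + <[x]>) <= n)%N.
  apply: maxU; apply/asboolP; exists (U + <[x]>)%VS => // y.
  by case/memv_addP => u uU [_ /vlineP[c ->] ->]; rewrite addrC; apply: p_lin px (pU u uU).
rewrite -dU leqNgt (ltn_leqif (dimv_leqif_sup (addvSl _ _))) negbK => /subvP; apply.
by rewrite (subvP (addvSr _ _)) // memv_line.
Qed.

Section FfunSpace.
Variables (I : finType) (W : vectType k) (U : I -> {vspace W}).

Definition single i (w : W) : {ffun I -> W} := [ffun j => if j == i then w else 0].

Lemma single_linear i : linear (single i).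
Proof.
move=> c x y; apply/ffunP => j; rewrite !ffunE.
by case: eqP; rewrite // scaler0 addr0.
Qed.

Definition ffun_vs := (\sum_i (linfun (single i) @: U i))%VS.

Lemma ffun_vsP (f : {ffun I -> W}) : reflect (forall i, f i \in U i) (f \in ffun_vs).
Proof.
apply: (iffP memv_sumP) => [[u uU ->] i|fU].
  rewrite sum_ffunE memv_suml // => j _.
  have /memv_imgP[w wU ->] := uU j isT.
  by rewrite linfunE ?ffunE; [case: eqP => [->|]; rewrite ?mem0v|exact: single_linear].
exists (fun i => single i (f i)) => [i _|].
  by rewrite -(linfunE (@single_linear i)) memv_img.
apply/ffunP => i; rewrite sum_ffunE (bigD1 i) //= ffunE eqxx big1 ?addr0 // => j ji.
by rewrite ffunE eq_sym (negbTE ji).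
Qed.

Lemma dim_ffun_vs : \dim ffun_vs = \sum_i \dim (U i).
Proof.
have /directvP/= -> : directv (\sum_i (linfun (single i) @: U i)).
  apply/directv_sum_independent => u uU u0 i _.
  have /memv_imgP[w wU uE] := uU i isT.
  move/(congr1 (fun f : {ffun I -> W} => f i)): u0.
  rewrite sum_ffunE (bigD1 i) //= big1 => [|j ji]; last first.
    have /memv_imgP[w' _ ->] := uU j isT.
    by rewrite linfunE ?ffunE 1?eq_sym ?(negbTE ji) //; exact: single_linear.
  rewrite addr0 uE linfunE; last exact: single_linear.
  rewrite !ffunE eqxx => ->.
  by apply/ffunP => j; rewrite !ffunE; case: eqP.
apply: eq_bigr => i _; apply: limg_dim_eq.
apply/eqP; rewrite -subv0; apply/subvP => u.
rewrite memv_cap memv_ker memv0 => /andP[_ /eqP].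
rewrite linfunE; last exact: single_linear.
by move=> /(congr1 (fun f : {ffun I -> W} => f i)); rewrite !ffunE eqxx => ->.
Qed.
End FfunSpace.

(** * Bases and coordinates for the action of a division algebra *)

Section DivisionAction.
Variables (D W : vectType k) (K : {vspace D}) (act : D -> W -> W).

(** Products, unit and inverses of scalars are only required to exist in K and to act correctly on
    Z. This covers at once the fields D_i acting on vertex parts, whose idempotents act as 1 only
    there, and endomorphism algebras acting on either side of Hom and of cocycles, where a right
    action reverses the product. *)
Record division_action (Z : {vspace W}) : Prop := DivisionAction {
  divact_linl : forall x, linear (act^~ x);
  divact_linr : forall c, linear (act c);
  divact_stable : forall c z, c \in K -> z \in Z -> act c z \in Z;
  divact_mul : forall c d, c \in K -> d \in K -> exists2 e, e \in K &
    forall z, z \in Z -> act c (act d z) = act e z;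
  divact_one : exists2 e, e \in K & forall z, z \in Z -> act e z = z;
  divact_inv : forall c, c \in K -> c != 0 -> exists2 d, d \in K &
    forall z, z \in Z -> act d (act c z) = z
}.

Variable Z : {vspace W}.
Hypothesis actZ : division_action Z.

Let actl0 x : act 0 x = 0.
Proof. by have := divact_linl actZ x (-1) 0 0; rewrite !scaleN1r oppr0 addr0 addNr. Qed.

Let actl x : {morph act^~ x : c d / c + d}.
Proof. by move=> c d; have := divact_linl actZ x 1 c d; rewrite /= !scale1r. Qed.

Let actlN x c : act (- c) x = - act c x.
Proof. by have := divact_linl actZ x (-1) c 0; rewrite /= !scaleN1r actl0 !addr0. Qed.

Let actr c : {morph act c : x y / x + y}.
Proof. by move=> x y; have := divact_linr actZ c 1 x y; rewrite /= !scale1r. Qed.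

Let comb r (w : 'I_r -> W) (c : {ffun 'I_r -> D}) := \sum_t act (c t) (w t).

Let comb_linear r (w : 'I_r -> W) : linear (comb w).
Proof.
move=> a c d; rewrite /comb scaler_sumr -big_split; apply: eq_bigr => t _ /=.
by rewrite !ffunE (divact_linl actZ).
Qed.

(** Induction on the codimension of B: pick z in Z outside B and enlarge B by the K-line of z. The
    coefficient of z is unique because a nonzero difference of two candidates could be inverted,
    which would put z in B. *)
Lemma dbasis_exists (B : {vspace W}) : (B <= Z)%VS ->
    (forall c b, c \in K -> b \in B -> act c b \in B) ->
  exists r (w : 'I_r -> W), is_dbasis K act Z B w.
Proof.
have [n] := ubnP (\dim Z - \dim B); elim: n B => // n IHn B ltn BZ actB.
have [ZB|] := boolP (Z <= B)%VS.
  exists 0%N, (fun=> 0); split=> [[]//|z zZ]; exists [ffun=> 0].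
  split; first by split=> [[]//|]; rewrite big_ord0 subr0 (subvP ZB).
  by move=> c _; apply/ffunP => -[].
case/subvPn => z zZ zB.
pose Kz := (linfun (act^~ z) @: K)%VS.
have KzE x : reflect (exists2 c, c \in K & x = act c z) (x \in Kz).
  have lE := linfunE (divact_linl actZ z).
  by apply: (iffP memv_imgP) => -[c cK ->]; exists c; rewrite ?lE.
have [one oneK act1] := divact_one actZ.
have zKz : z \in Kz by apply/KzE; exists one; rewrite // act1.
have [r [w [wZ wB]]] : exists r (w : 'I_r -> W), is_dbasis K act Z (B + Kz)%VS w.
  apply: IHn.
  - have ltB : (\dim B < \dim (B + Kz))%N.
      rewrite (ltn_leqif (dimv_leqif_sup (addvSl B Kz))).
      by apply/negP => /subvP/(_ z (subvP (addvSr B Kz) z zKz)); apply/negP.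
    have leZ : (\dim (B + Kz) <= \dim Z)%N.
      apply: dimvS; rewrite subv_add BZ /=; apply/subvP => x /KzE[c cK ->].
      exact: (divact_stable actZ).
    by apply: leq_trans (ltn_sub2l (leq_trans ltB leZ) ltB) _; rewrite -ltnS.
  - rewrite subv_add BZ /=; apply/subvP => x /KzE[c cK ->].
    exact: (divact_stable actZ).
  move=> c x cK /memv_addP[b bB [y /KzE[d dK ->] ->]].
  have [e eK cd] := divact_mul actZ cK dK.
  by rewrite actr cd // memv_add ?actB //; apply/KzE; exists e.
exists r.+1, (fun t => if unlift ord0 t is Some t' then w t' else z).
have sumE (c : {ffun 'I_r.+1 -> D}) :
   \sum_t act (c t) (if unlift ord0 t is Some t' then w t' else z) =
   act (c ord0) z + \sum_t act (c (lift ord0 t)) (w t).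
  rewrite big_ord_recl unlift_none; congr (_ + _).
  by apply: eq_bigr => t _; rewrite liftK.
split=> [t|x xZ]; first by case: unliftP => [t' _|_].
have [c [[cK cB] cU]] := wB x xZ.
have /memv_addP[b bB [y /KzE[d dK ->] xE]] := cB.
exists [ffun t => if unlift ord0 t is Some t' then c t' else d]; split.
  split=> [t|]; first by rewrite ffunE; case: unliftP.
  rewrite sumE ffunE unlift_none.
  rewrite (eq_bigr (fun t => act (c t) (w t))) => [|t _]; last by rewrite ffunE liftK.
  by rewrite opprD addrA addrAC xE addrK.
move=> c' [c'K]; rewrite sumE => c'B.
have combE : \sum_t act ([ffun t => c' (lift ord0 t)] t) (w t) =
    \sum_t act (c' (lift ord0 t)) (w t).
  by apply: eq_bigr => t _; rewrite ffunE.
have cE : c = [ffun t => c' (lift ord0 t)].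
  apply: cU; split=> [t|]; first by rewrite ffunE.
  rewrite combE -[X in X \in _](subrK (act (c' ord0) z)).
  rewrite -[x - _ - _]addrA -opprD [in X in x - X]addrC.
  by apply: memv_add => //; apply/KzE; exists (c' ord0).
apply/ffunP => t; rewrite ffunE; case: unliftP => [t' ->|->].
  by rewrite cE ffunE.
have dB : act (d - c' ord0) z \in B.
  move: c'B; rewrite opprD addrA addrAC -combE -cE xE => c'B.
  by rewrite actl actlN -[_ - _](addKr b) [b + _]addrA rpredD ?rpredN.
apply/eqP; rewrite -subr_eq0; apply/negPn/negP => dc.
have [d' d'K dd'] := divact_inv actZ (rpredB dK (c'K ord0)) dc.
by case/negP: zB; rewrite -(dd' z zZ) actB.
Qed.

Lemma dbasis_dim (B : {vspace W}) r (w : 'I_r -> W) : (B <= Z)%VS ->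
  is_dbasis K act Z B w -> \dim Z = (r * \dim K + \dim B)%N.
Proof.
move=> BZ [wZ wB].
pose C := ffun_vs (fun _ : 'I_r => K).
have combZ c : c \in C -> comb w c \in Z.
  move/ffun_vsP => cK; apply: memv_suml => t _.
  exact: (divact_stable actZ).
pose J := (linfun (comb w) @: C)%VS.
have lE := linfunE (comb_linear w).
have inj c : c \in C -> comb w c \in B -> c = 0.
  move=> cC cB; have [c0 [_ c0U]] := wB _ (combZ c cC).
  rewrite -(c0U c); last by split; [apply/ffun_vsP|rewrite subrr mem0v].
  apply: c0U; split=> [t|]; first by rewrite ffunE mem0v.
  by rewrite big1 ?subr0 // => t _; rewrite ffunE actl0.
have -> : Z = (J + B)%VS.
  apply/vspaceP => z; apply/idP/memv_addP => [zZ|[y /memv_imgP[c cC ->] [b bB ->]]].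
    have [c [[cK cB] _]] := wB z zZ; exists (comb w c).
      by rewrite -lE memv_img //; apply/ffun_vsP.
    by exists (z - comb w c); rewrite // addrC subrK.
  by apply: rpredD; [rewrite lE; apply: combZ|apply: (subvP BZ)].
rewrite dimv_disjoint_sum.
  congr (_ + _)%N; rewrite limg_dim_eq; last first.
    apply/eqP; rewrite -subv0; apply/subvP => c.
    rewrite memv_cap memv_ker memv0 lE => /andP[cC /eqP c0].
    by apply/eqP/inj; rewrite // c0 mem0v.
  by rewrite dim_ffun_vs sum_nat_const card_ord.
apply/eqP; rewrite -subv0; apply/subvP => x.
rewrite memv_cap memv0 => /andP[/memv_imgP[c cC ->]]; rewrite lE => cB.
by rewrite (inj c) // -lE linear0.
Qed.

(** Composing with a linear map [pi] into Z makes the coordinates linear on the whole of W; [pi]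
    will be a vertex idempotent or the identity. *)
Lemma dbasis_coord r (w : 'I_r -> W) (pi : W -> W) :
    linear pi -> (forall x, pi x \in Z) -> is_dbasis K act Z 0 w ->
  exists co : W -> {ffun 'I_r -> D}, [/\ linear co, forall x t, co x t \in K,
    forall x, pi x = \sum_t act (co x t) (w t) &
    forall x (c : {ffun 'I_r -> D}), (forall t, c t \in K) ->
      pi x = \sum_t act (c t) (w t) -> c = co x].
Proof.
move=> lin_pi piZ [wZ wB].
have [co coP] := choice (fun x => wB _ (piZ x)).
have coK x t : co x t \in K by have [[]] := coP x.
have coE x : pi x = \sum_t act (co x t) (w t).
  by have [[_]] := coP x; rewrite memv0 subr_eq0 => /eqP.
have coU x (c : {ffun 'I_r -> D}) : (forall t, c t \in K) ->
    pi x = \sum_t act (c t) (w t) -> c = co x.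
  move=> cK cE; have [_ cU] := coP x; apply/esym/cU; split=> //.
  by rewrite cE subrr mem0v.
exists co; split=> // c x y; apply/esym/coU => [t|].
  by rewrite !ffunE rpredD ?rpredZ.
by rewrite lin_pi !coE; apply/esym/(@comb_linear _ w).
Qed.

Section Ddim.
Variable B : {vspace W}.
Hypotheses (BZ : (B <= Z)%VS) (actB : forall c b, c \in K -> b \in B -> act c b \in B).

Lemma ddim_basis : exists w : 'I_(ddim K act Z B) -> W, is_dbasis K act Z B w.
Proof.
exact: (@xgetPex _ 0%N (fun r => exists w : 'I_r -> W, is_dbasis K act Z B w)
  (dbasis_exists BZ actB)).
Qed.

(** The value of [ddim] is picked by choice; the existence of a basis makes it meaningful, and
    counting k-dimensions then gives access to it. *)
Lemma ddim_dim : \dim Z = (ddim K act Z B * \dim K + \dim B)%N.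
Proof. by have [w] := ddim_basis; apply: dbasis_dim. Qed.
End Ddim.
End DivisionAction.
End LinearAlgebra.

(** * Derivations of the tensor algebra *)

Section TrivialExtension.
Variables (k : fieldType) (A : falgType k) (X Y : lmodA A).

(** The square-zero extension of A by the bimodule Hom_k(X, Y). *)
Definition trivext : Type := (A * 'Hom(X, Y))%type.
Implicit Types s t u : trivext.

Definition te_mul s t : trivext :=
  (s.1 * t.1, (mact Y s.1 \o t.2)%VF + (s.2 \o mact X t.1)%VF).

Fact te_mulA : associative te_mul.
Proof.
move=> s t u; rewrite /te_mul /= mulrA; congr (_, _).
by rewrite !mactM comp_lfunDl comp_lfunDr !comp_lfunA addrA.
Qed.

Fact te_mul1x : left_id (1, 0) te_mul.
Proof.
by move=> [a h]; rewrite /te_mul /= mul1r mact1 comp_lfun1l comp_lfun0l addr0.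
Qed.

Fact te_mulx1 : right_id (1, 0) te_mul.
Proof.
by move=> [a h]; rewrite /te_mul /= mulr1 mact1 comp_lfun1r comp_lfun0r add0r.
Qed.

Fact te_mulDl : left_distributive te_mul +%R.
Proof.
move=> s t u; rewrite /te_mul /= mulrDl; congr (_, _).
by rewrite linearD /= !comp_lfunDl addrACA.
Qed.

Fact te_mulDr : right_distributive te_mul +%R.
Proof.
move=> s t u; rewrite /te_mul /= mulrDr; congr (_, _).
by rewrite linearD /= !comp_lfunDr addrACA.
Qed.

Fact te_1neq0 : ((1, 0) : trivext) != 0.
Proof. by apply/eqP => -[/eqP]; rewrite oner_eq0. Qed.

Fact te_scaleAl c s t : c *: te_mul s t = te_mul (c *: s) t.
Proof.
rewrite /te_mul; congr (_, _); rewrite /= ?scalerAl //.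
by rewrite scalerDr linearZ /= !comp_lfunZl.
Qed.

Fact te_scaleAr c s t : c *: te_mul s t = te_mul s (c *: t).
Proof.
rewrite /te_mul; congr (_, _); rewrite /= ?scalerAr //.
by rewrite scalerDr linearZ /= !comp_lfunZr.
Qed.

HB.instance Definition _ := GRing.Lmodule.copy trivext (A * 'Hom(X, Y))%type.
HB.instance Definition _ := GRing.Zmodule_isNzRing.Build trivext
  te_mulA te_mul1x te_mulx1 te_mulDl te_mulDr te_1neq0.
HB.instance Definition _ :=
  GRing.Lmodule_isLalgebra.Build k trivext te_scaleAl.
HB.instance Definition _ :=
  GRing.Lalgebra_isAlgebra.Build k trivext te_scaleAr.

Lemma te_fst_linear : linear (fst : trivext -> A).
Proof. by []. Qed.
Lemma te_fst_monoid : monoid_morphism (fst : trivext -> A).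
Proof. by []. Qed.
Definition te_fst : {lrmorphism trivext -> A} := HB.pack (fst : trivext -> A)
  (GRing.isLinear.Build _ _ _ _ _ te_fst_linear)
  (GRing.isMonoidMorphism.Build _ _ _ te_fst_monoid).
End TrivialExtension.

(** * Generation of the tensor algebra by its vertices and arrows *)

Section Generation.
Variables (k : fieldType) (m : nat) (Q : vquiver m) (Sp : species k Q).
Variables (T : tensor_algebra Sp) (p : {pred T}).
Hypothesis p_subalg : subalg_closed p.
Hypothesis p_fD : forall i c, fD (tmap T) i c \in p.
Hypothesis p_fM : forall i j x, fM (tmap T) i j x \in p.

HB.instance Definition _ := GRing.isSubalgClosed.Build k T p p_subalg.
Record subalg := Subalg { subalg_val : T; _ : subalg_val \in p }.
HB.instance Definition _ := [isSub for subalg_val].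
HB.instance Definition _ := [Choice of subalg by <:].
HB.instance Definition _ := [SubChoice_isSubAlgebra of subalg by <:].

Let gD i c := Subalg (@p_fD i c).
Let gM i j x := Subalg (@p_fM i j x).

Fact gD_linear i : linear (@gD i).
Proof. by move=> a x y; apply/val_inj; rewrite /= linearP. Qed.
Fact gM_linear i j : linear (@gM i j).
Proof. by move=> a x y; apply/val_inj; rewrite /= linearP. Qed.

(** The subalgebra [p] receives a map from the species, hence from T; followed by the inclusion it
    extends the canonical map, so it is the identity by uniqueness and every element lies in [p]. *)
Lemma tensor_algebra_gen a : a \in p.
Proof.
pose hD i : {linear sD Sp i -> subalg} := HB.pack (@gD i)
  (GRing.isLinear.Build _ _ _ _ _ (@gD_linear i)).
pose hM i j : {linear sM Sp i j -> subalg} := HB.pack (@gM i j)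
  (GRing.isLinear.Build _ _ _ _ _ (@gM_linear i j)).
have hDM i x y : hD i (x * y) = hD i x * hD i y by apply/val_inj; rewrite /= fDM.
have hD0 i j x y : i != j -> hD i x * hD j y = 0.
  by move=> ij; apply/val_inj; rewrite /= fD0.
have hD1 : \sum_i hD i 1 = 1 by apply/val_inj; rewrite raddf_sum /= fD1.
have hMl i j c x : hM i j (lactM c x) = hD j c * hM i j x.
  by apply/val_inj; rewrite /= fM_l.
have hMr i j c x : hM i j (ractM x c) = hM i j x * hD i c.
  by apply/val_inj; rewrite /= fM_r.
pose w := SpeciesMap hDM hD0 hD1 hMl hMr.
have [[phi [phiD phiM]] _] := tmap_univ T w.
have [_ uniq] := tmap_univ T (tmap T).
have incl_lin : linear (val : subalg -> T) by [].
have incl_mon : monoid_morphism (val : subalg -> T) by [].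
pose incl : {lrmorphism subalg -> T} := HB.pack (val : subalg -> T)
  (GRing.isLinear.Build _ _ _ _ _ incl_lin)
  (GRing.isMonoidMorphism.Build _ _ _ incl_mon).
have <- : incl (phi a) = a; last exact: valP.
apply: (uniq (incl \o phi) idfun) => //.
by split=> [i x|i j x] /=; rewrite ?phiD ?phiM.
Qed.
End Generation.

Section Derivations.
Variables (k : fieldType) (m : nat) (Q : vquiver m) (Sp : species k Q).
Variables (T : tensor_algebra Sp) (X Y : lmodA T).
Local Notation DD := (fD (tmap T)).
Local Notation MM := (fM (tmap T)).

(** By the Leibniz rule the zeros of a derivation form a subalgebra. *)
Lemma ext_Z_unique (dl : 'Hom(T, 'Hom(X, Y))) : dl \in ext_Z X Y ->
  (forall i c, dl (DD i c) = 0) -> (forall i j x, dl (MM i j x) = 0) -> dl = 0.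
Proof.
move=> /ext_ZP dlM dlD0 dlM0; apply/lfunP => a; rewrite zero_lfunE.
apply/eqP; have -> : (dl a == 0) = (a \in [pred b | dl b == 0]) by rewrite inE.
apply: tensor_algebra_gen.
- split; first by rewrite inE -(fD1 (tmap T)) linear_sum big1 // => i _; apply: dlD0.
  + by move=> c x y; rewrite !inE linearP /= => /eqP-> /eqP->; rewrite scaler0 addr0.
  move=> x y; rewrite !inE => /eqP x0 /eqP y0; apply/eqP/lfunP => z.
  by rewrite dlM x0 y0 !zero_lfunE linear0 addr0.
- by move=> i c; rewrite inE dlD0.
- by move=> i j x; rewrite inE dlM0.
Qed.

(* The algebra morphisms a |-> (a, delta a) from T to the trivial extension   *)
(* are exactly those given by the derivations delta.                         *)
Lemma ext_Z_exists (h : forall i j, sM Sp i j -> 'Hom(X, Y)) :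
    (forall i j, linear (h i j)) ->
    (forall i j c x, h i j (lactM c x) = (mact Y (DD j c) \o h i j x)%VF) ->
    (forall i j c x, h i j (ractM x c) = (h i j x \o mact X (DD i c))%VF) ->
  exists dl, [/\ dl \in ext_Z X Y, forall i c, dl (DD i c) = 0 &
                 forall i j x, dl (MM i j x) = h i j x].
Proof.
move=> h_lin hl hr.
pose gD i c : trivext X Y := (DD i c, 0).
pose gM i j x : trivext X Y := (MM i j x, h i j x).
have gD_lin i : linear (@gD i).
  by move=> c x y; rewrite /gD linearP /=; congr (_, _); rewrite /= ?scaler0 ?addr0.
have gM_lin i j : linear (@gM i j).
  by move=> c x y; rewrite /gM linearP h_lin.
pose hD i : {linear sD Sp i -> trivext X Y} := HB.pack (@gD i)
  (GRing.isLinear.Build _ _ _ _ _ (@gD_lin i)).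
pose hM i j : {linear sM Sp i j -> trivext X Y} := HB.pack (@gM i j)
  (GRing.isLinear.Build _ _ _ _ _ (@gM_lin i j)).
have hDM i x y : hD i (x * y) = hD i x * hD i y.
  by congr (_, _); rewrite /= ?fDM // comp_lfun0l comp_lfun0r addr0.
have hD0 i j x y : i != j -> hD i x * hD j y = 0.
  by move=> ij; congr (_, _); rewrite /= ?fD0 // comp_lfun0l comp_lfun0r addr0.
have hD1 : \sum_i hD i 1 = 1.
  rewrite -[RHS]/(1, 0) -(fD1 (tmap T)).
  elim/big_rec2: _ => [|i x y _ ->]; congr (_, _).
  by rewrite /= addr0.
have hMl i j c x : hM i j (lactM c x) = hD j c * hM i j x.
  by congr (_, _); rewrite /= ?fM_l // hl comp_lfun0l addr0.
have hMr i j c x : hM i j (ractM x c) = hM i j x * hD i c.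
  by congr (_, _); rewrite /= ?fM_r // hr comp_lfun0r add0r.
have [[phi [phiD phiM]] _] := tmap_univ T (SpeciesMap hDM hD0 hD1 hMl hMr).
have [_ uniq] := tmap_univ T (tmap T).
(* The first component is an endomorphism of T fixing the generators, so it is the identity;
   multiplicativity of [phi] then says that the second component is a derivation. *)
have phi1 a : (phi a).1 = a.
  apply: (uniq (te_fst X Y \o phi) idfun) => //.
  by split=> [i x|i j x] /=; rewrite ?phiD ?phiM.
have lin2 : linear (fun a => (phi a).2) by move=> c a b; rewrite linearP.
exists (linfun (fun a => (phi a).2)); split.
- apply/ext_ZP => a b x; rewrite !linfunE // rmorphM /=.
  by rewrite add_lfunE !comp_lfunE !phi1.
- by move=> i c; rewrite linfunE // phiD.
- by move=> i j x; rewrite linfunE // phiM.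
Qed.

End Derivations.

(** * Modules, extensions and the Nakayama functor *)

Section Modules.
Variables (k : fieldType) (A : falgType k).
Implicit Types (M N P I X Y : lmodA A).

Lemma mactE1 M x : mact M 1 x = x.
Proof. by rewrite mact1 id_lfunE. Qed.

Lemma mactME M a b x : mact M (a * b) x = mact M a (mact M b x).
Proof. by rewrite mactM comp_lfunE. Qed.

Lemma lmodA_build (V : vectType k) (act : A -> V -> V) :
    (forall a, linear (act a)) -> (forall x, linear (act^~ x)) ->
    (forall x, act 1 x = x) -> (forall a b x, act (a * b) x = act a (act b x)) ->
  exists2 f : {linear A -> 'End(V)}, (f 1 = \1%VF /\
     forall a b, f (a * b) = (f a \o f b)%VF) & forall a x, f a x = act a x.
Proof.
move=> lin_a lin_x act1 actM; pose F a := linfun (act a).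
have FE a x : F a x = act a x by rewrite linfunE.
have lin_F : linear F.
  by move=> c a b; apply/lfunP => x; rewrite add_lfunE scale_lfunE !FE lin_x.
pose f : {linear A -> 'End(V)} :=
  HB.pack F (GRing.isLinear.Build _ _ _ _ F lin_F).
exists f => //=.
by split=> [|a b]; apply/lfunP => x; rewrite ?id_lfunE ?comp_lfunE !FE.
Qed.

Lemma submodP M (U : {vspace M}) : submodule U ->
  exists (N : lmodA A) (u : 'Hom(N, M)), [/\ u \in homA N M, lker u = 0%VS & limg u = U].
Proof.
move/asboolP => hU.
pose act a (v : subvs_of U) := vsproj U (mact M a (vsval v)).
have actE a v : vsval (act a v) = mact M a (vsval v).
  by rewrite vsprojK // hU ?subvsP.
have [|||a b x|f [f1 fM] fE] := @lmodA_build (subvs_of U) act.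
- by move=> a c x y; apply/val_inj; rewrite /= !actE !linearP.
- move=> x c a b; apply/val_inj; rewrite /= !actE linearP /=.
  by rewrite add_lfunE scale_lfunE.
- by move=> x; apply/val_inj; rewrite /= actE mactE1.
- by apply/val_inj; rewrite /= !actE mactME.
have uE := @linfunE _ (subvs_of U) M vsval (fun c x y => erefl).
exists (LmodA f1 fM), (linfun (vsval : subvs_of U -> M)); split.
- by apply/(homAP (M := LmodA f1 fM)) => a x; rewrite !uE /= fE actE.
- apply/eqP; rewrite -subv0; apply/subvP => x; rewrite memv_ker uE memv0.
  by move/eqP => x0; apply/eqP/val_inj.
- apply/vspaceP => x; apply/memv_imgP/idP => [[y _ ->]|xU].
    by rewrite uE subvsP.
  by exists (vsproj U x); rewrite ?memvf // uE vsprojK.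
Qed.

(** The extension of X by Y with class [dl]: the space Y x X with [dl] as off-diagonal entry of the
    action. The maps [s] and [r] are its k-linear splittings. *)
Lemma ext_module X Y (dl : 'Hom(A, 'Hom(X, Y))) : dl \in ext_Z X Y ->
  exists (E : lmodA A) (u : 'Hom(Y, E)) (s : 'Hom(X, E))
    (p : 'Hom(E, X)) (r : 'Hom(E, Y)),
    [/\ u \in homA Y E, p \in homA E X,
        [/\ (p \o s = \1)%VF, (r \o u = \1)%VF & (r \o s = 0)%VF],
        forall e, e = u (r e) + s (p e) &
        forall a x, mact E a (s x) = u (dl a x) + s (mact X a x)].
Proof.
move/ext_ZP => dlM.
have dl1 x : dl 1 x = 0.
  have := dlM 1 1 x; rewrite mulr1 !mactE1 => /(congr1 (fun z => z - dl 1 x)).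
  by rewrite subrr addrK.
pose act a (e : Y * X) : Y * X := (mact Y a e.1 + dl a e.2, mact X a e.2).
have [|||a b [y x]|f [f1 fM] fE] := @lmodA_build (Y * X)%type act.
- move=> a c [y x] [y' x']; rewrite /act /= !linearP /=; congr (_, _) => //=.
  by rewrite scalerDr addrACA.
- move=> [y x] c a b; rewrite /act /= !linearP /=; congr (_, _) => /=.
    by rewrite !add_lfunE !scale_lfunE scalerDr addrACA.
  by rewrite !add_lfunE !scale_lfunE.
- by move=> [y x]; rewrite /act /= !mactE1 dl1 addr0.
- by rewrite /act /= !mactME dlM linearD /= addrA.
pose E := LmodA f1 fM.
have uE : linfun (fun y : Y => (y, 0) : E) =1 (fun y => (y, 0)).
  by apply: linfunE => c y y'; congr (_, _); rewrite /= ?scaler0 ?addr0.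
have sE : linfun (fun x : X => (0, x) : E) =1 (fun x => (0, x)).
  by apply: linfunE => c y y'; congr (_, _); rewrite /= ?scaler0 ?addr0.
have pE : linfun (snd : E -> X) =1 snd by apply: linfunE.
have rE : linfun (fst : E -> Y) =1 fst by apply: linfunE.
exists E, (linfun (fun y : Y => (y, 0) : E)), (linfun (fun x : X => (0, x) : E)).
exists (linfun (snd : E -> X)), (linfun (fst : E -> Y)); split.
- by apply/(homAP (M := Y) (N := E)) => a y; rewrite !uE /= fE /act /= !linear0 addr0.
- by apply/(homAP (M := E) (N := X)) => a e; rewrite !pE /= fE.
- split; apply/lfunP => x; rewrite comp_lfunE ?id_lfunE ?zero_lfunE.
  + by rewrite pE sE.
  + by rewrite rE uE.
  + by rewrite rE sE.
- by move=> [y x]; rewrite uE sE rE pE /=; congr (_, _); rewrite /= ?addr0 ?add0r.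
- move=> a x; rewrite !sE uE /= fE /act /= linear0 add0r.
  by congr (_, _); rewrite /= ?addr0 ?add0r.
Qed.

Lemma ext_dim0 X Y : (ext_Z X Y <= ext_B X Y)%VS -> ext_dim X Y = 0%N.
Proof. by move/dimvS => ZB; apply/eqP; rewrite subn_eq0. Qed.

Lemma id_homA M : \1%VF \in homA M M.
Proof. by apply/homAP => a x; rewrite !id_lfunE. Qed.

Lemma comp_homA X Y M (h : 'Hom(Y, M)) (h' : 'Hom(X, Y)) :
  h \in homA Y M -> h' \in homA X Y -> (h \o h')%VF \in homA X M.
Proof.
by move=> /homAP hA /homAP hA'; apply/homAP => a x; rewrite !comp_lfunE hA' hA.
Qed.

(** A module section s' of the extension given by a cocycle exists by projectivity, and its
    Y-component r s' exhibits the cocycle as a coboundary. *)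
Lemma ext_projective P X : projective P -> ext_dim P X = 0%N.
Proof.
move=> projP; apply: ext_dim0; apply/subvP => dl.
case/ext_module => E [u [s [p [r [/homAP uA pA [ps ru rs] eE actE]]]]].
have pfull : limg p = fullv.
  apply/eqP; rewrite eqEsubv subvf /=; apply/subvP => x _.
  by apply/memv_imgP; exists (s x); rewrite ?memvf // -comp_lfunE ps id_lfunE.
have [s' /homAP s'A ps'] := projP _ _ _ _ pA pfull (id_homA P).
have s'E x : s' x = u (r (s' x)) + s x.
  by rewrite {1}(eE (s' x)) -[p _]comp_lfunE ps' id_lfunE.
have rK y x : r (u y + s x) = y.
  rewrite linearD /= -[r (u y)]comp_lfunE -[r (s x)]comp_lfunE ru rs.
  by rewrite id_lfunE zero_lfunE addr0.
apply/ext_BP; exists (r \o s')%VF => a x; rewrite !comp_lfunE s'A {1}s'E.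
by rewrite linearD /= actE -uA addrA -linearD /= rK addrAC subrr add0r.
Qed.

(** Dually, a module retraction r' of the extension exists, and -r' s exhibits the cocycle as a
    coboundary. *)
Lemma ext_injective I X : injective_mod I -> ext_dim X I = 0%N.
Proof.
move=> injI; apply: ext_dim0; apply/subvP => dl.
case/ext_module => E [u [s [p [r [uA pA [ps ru rs] eE actE]]]]].
have u0 : lker u = 0%VS.
  apply/eqP; rewrite -subv0; apply/subvP => y; rewrite memv_ker memv0 => /eqP uy.
  by rewrite -[y]id_lfunE -ru comp_lfunE uy linear0.
have [r' /homAP r'A r'u] := injI _ _ _ _ uA u0 (id_homA I).
apply/ext_BP; exists (- (r' \o s))%VF => a x.
rewrite !opp_lfunE !comp_lfunE linearN /= opprK -r'A actE linearD /= addrC.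
by rewrite -[r' (u _)]comp_lfunE r'u id_lfunE addrK.
Qed.

Lemma iso_hom_dim X Y Y' : isomorphic Y Y' -> hom_dim X Y = hom_dim X Y'.
Proof.
case=> h [hA [h' h'A [h'h hh']]].
apply: (@dim_bij _ _ _ (fun f => (h \o f)%VF)).
- by move=> c f f'; rewrite comp_lfunDr -comp_lfunZr.
- by move=> f; apply: comp_homA.
- by move=> f _ f0; rewrite -[f]comp_lfun1l -h'h -comp_lfunA f0 comp_lfun0r.
- move=> f fA; exists (h' \o f)%VF; first exact: comp_homA.
  by rewrite comp_lfunA hh' comp_lfun1l.
Qed.

Lemma free_module r : exists (F : lmodA A) (e : 'Hom(F, {ffun 'I_r -> A}))
    (e' : 'Hom({ffun 'I_r -> A}, F)),
  [/\ forall x, e' (e x) = x, forall c, e (e' c) = c &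
    forall a x t, e (mact F a x) t = a * e x t].
Proof.
pose act a (c : {ffun 'I_r -> A}) := [ffun t => a * c t].
have [|||a b x|f [f1 fM] fE] := @lmodA_build {ffun 'I_r -> A} act.
- by move=> a c x y; apply/ffunP => t; rewrite !ffunE mulrDr scalerAr.
- by move=> x c a b; apply/ffunP => t; rewrite !ffunE mulrDl scalerAl.
- by move=> x; apply/ffunP => t; rewrite !ffunE mul1r.
- by apply/ffunP => t; rewrite !ffunE mulrA.
exists (LmodA f1 fM), \1%VF, \1%VF; split=> [x|x|a x t]; rewrite ?id_lfunE //.
by rewrite /= fE ffunE.
Qed.

(** The identity of P lifts through the surjection from a free module given by a k-basis of P; the
    coordinates of the lift are the forms [h]. *)
Lemma dual_basis P : projective P ->
  exists r (p : 'I_r -> P) (h : 'I_r -> 'Hom(P, reg_lmodA A)),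
    (forall t, h t \in homA P (reg_lmodA A)) /\
    forall y, y = \sum_t mact P (h t y : A) (p t).
Proof.
move=> projP; pose r := \dim {:P}; pose p t := (vbasis {:P})`_t : P.
have [F [e [e' [e'e ee' eA]]]] := free_module r.
have qE : linfun (fun x : F => \sum_(t < r) mact P (e x t) (p t)) =1
    (fun x : F => \sum_(t < r) mact P (e x t) (p t)).
  apply: linfunE => c x y; rewrite scaler_sumr -big_split; apply: eq_bigr => t _.
  by rewrite linearP /= !ffunE linearP /= add_lfunE scale_lfunE.
set q := linfun _ in qE.
have qA : q \in homA F P.
  apply/homAP => a x; rewrite !qE linear_sum; apply: eq_bigr => t _.
  by rewrite eA mactME.
have qfull : limg q = fullv.
  apply/eqP; rewrite eqEsubv subvf /=; apply/subvP => y _.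
  apply/memv_imgP; exists (e' [ffun t => (coord (vbasis {:P}) t y)%:A]).
    exact: memvf.
  rewrite qE ee' {1}(coord_vbasis (memvf y)); apply: eq_bigr => t _.
  by rewrite ffunE linearZ /= mact1 scale_lfunE id_lfunE.
have [s sA qs] := projP _ _ _ _ qA qfull (id_homA P).
have hE t : linfun (fun y : P => e (s y) t : reg_lmodA A) =1 (fun y => e (s y) t).
  by apply: linfunE => c x y; rewrite !linearP !ffunE.
exists r, p, (fun t => linfun (fun y : P => e (s y) t : reg_lmodA A)); split.
  move=> t; apply/homAP => a x; move/homAP: sA => sA.
  by rewrite !hE sA eA /= lfunE.
move=> y; rewrite -{1}[y]id_lfunE -qs comp_lfunE qE.
by apply: eq_bigr => t _; rewrite hE.
Qed.

Lemma dimv_dual (V : vectType k) : \dim (fullv : {vspace 'Hom(V, k^o)}) = \dim {:V}.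
Proof. by rewrite !dimvf /dim /= muln1. Qed.

(* With a dual basis (p_t, h_t) of P, the isomorphism from Hom(X, nu P) to    *)
(* the dual of Hom(P, X) sends b to phi |-> \sum_t b(phi(p_t))(h_t).          *)
Lemma nakayama_hom_dim P X : projective P -> hom_dim X (nakayama P) = hom_dim P X.
Proof.
move=> projP; have [r [p [h [hA pE]]]] := dual_basis projP.
pose R := reg_lmodA A; pose V := subvs_of (homA P R).
have RE a x : mact R a x = a * x by rewrite /= lfunE.
have dimE : hom_dim P X = \dim (fullv : {vspace 'Hom(subvs_of (homA P X), k^o)}).
  by rewrite dimv_dual dimvf.
pose hV t : V := vsproj (homA P R) (h t).
have hVE t : vsval (hV t) = h t by rewrite vsprojK.
have rankE (g : V) x : linfun (fun y : P => mact X ((vsval g : 'Hom(P, R)) y : A) x) =1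
    (fun y => mact X ((vsval g : 'Hom(P, R)) y : A) x).
  by apply: linfunE => c y y'; rewrite !linearP /= add_lfunE scale_lfunE.
pose rank1 (g : V) x := vsproj (homA P X)
  (linfun (fun y : P => mact X ((vsval g : 'Hom(P, R)) y : A) x)).
have rank1E g x y : (vsval (rank1 g x) : 'Hom(P, X)) y =
    mact X ((vsval g : 'Hom(P, R)) y : A) x.
  rewrite vsprojK ?rankE //; apply/homAP => a z; rewrite !rankE.
  by have /homAP -> := subvsP g; rewrite RE mactME.
pose xi (b : 'Hom(X, nakayama P)) (phi : subvs_of (homA P X)) : k^o :=
  \sum_t (b ((vsval phi : 'Hom(P, X)) (p t)) : 'Hom(V, k^o)) (hV t).
have xiE b : linfun (xi b) =1 xi b.
  apply: linfunE => c f g; rewrite /xi scaler_sumr -big_split /=.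
  apply: eq_bigr => t _; rewrite add_lfunE scale_lfunE linearP /=.
  by rewrite add_lfunE scale_lfunE.
rewrite dimE; apply: (@dim_bij _ _ _ (fun b => linfun (xi b))).
- move=> c b b'; apply/lfunP => phi; rewrite add_lfunE scale_lfunE !xiE.
  rewrite /xi scaler_sumr -big_split; apply: eq_bigr => t _ /=.
  by rewrite !(add_lfunE, scale_lfunE).
- by move=> b _; apply: memvf.
- move=> b /homAP bA b0; apply/lfunP => x; apply/lfunP => g.
  rewrite !zero_lfunE.
  have := congr1 (fun z : 'Hom(_, _) => z (rank1 g x)) b0.
  rewrite zero_lfunE xiE /xi => xi0.
  rewrite -[RHS]xi0.
  have gE : g = \sum_t dual_ract P ((vsval g : 'Hom(P, R)) (p t) : A) (hV t).
    apply/val_inj/lfunP => y; rewrite {1}(pE y) /= linear_sum linear_sum sum_lfunE.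
    apply: eq_bigr => t _ /=; have /homAP -> := subvsP g.
    by rewrite RE dual_ractE hVE.
  rewrite {1}gE linear_sum; apply: eq_bigr => t _ /=.
  by rewrite rank1E bA /= nakayama_actE.
move=> z _.
have betaE x : linfun (fun g : V => z (rank1 g x)) =1 (fun g => z (rank1 g x)).
  apply: linfunE => c g g'; rewrite -linearP; congr (z _).
  apply/val_inj/lfunP => y; rewrite /= add_lfunE scale_lfunE !rank1E /=.
  by rewrite add_lfunE scale_lfunE linearP /= add_lfunE scale_lfunE.
pose b0 (x : X) : nakayama P := linfun (fun g : V => z (rank1 g x)).
have b0E : linfun b0 =1 b0.
  apply: linfunE => c x x'; apply/lfunP => g.
  rewrite add_lfunE scale_lfunE !betaE -linearP; congr (z _).
  apply/val_inj/lfunP => y; rewrite /= add_lfunE scale_lfunE !rank1E.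
  by rewrite linearP.
exists (linfun b0).
  apply/homAP => a x; rewrite !b0E; apply/lfunP => g.
  rewrite /= nakayama_actE !betaE; congr (z _).
  by apply/val_inj/lfunP => y; rewrite !rank1E dual_ractE mactME.
apply/lfunP => phi; rewrite xiE /xi.
under eq_bigr do rewrite b0E betaE.
rewrite -linear_sum; congr (z _); apply/val_inj/lfunP => y.
rewrite linear_sum sum_lfunE [in RHS](pE y) linear_sum; apply: eq_bigr => t _ /=.
by rewrite rank1E hVE; have /homAP -> := subvsP phi.
Qed.
End Modules.

(** * Dimension vectors *)

Lemma sum_tag (I : finType) (J : I -> finType) (F : I -> nat) :
  (\sum_(u : {i : I & J i}) F (tag u) = \sum_i #|J i| * F i)%N.
Proof.
rewrite (eq_bigl (fun u : {i : I & J i} => true && true)) //.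
rewrite -(sig_big_dep xpredT (fun _ _ => true) (fun i _ => F i)).
by apply: eq_bigr => i _; rewrite sum_nat_const.
Qed.

Section DimensionVectors.
Variables (k : finFieldType) (m : nat) (Q : vquiver m) (Sp : species k Q).
Variable (T : tensor_algebra Sp).
Implicit Types X Y : lmodA T.
Local Notation DD := (fD (tmap T)).
Local Notation MM := (fM (tmap T)).

Definition dact X i (c : sD Sp i) (x : X) : X := mact X (DD i c) x.

Arguments dact [X] i c x.

Lemma dactM X i c d (x : X) : dact i (c * d) x = dact i c (dact i d x).
Proof. by rewrite /dact fDM mactME. Qed.

Lemma dact0 X i j (c : sD Sp i) (d : sD Sp j) (x : X) :
  i != j -> dact i c (dact j d x) = 0.
Proof. by move=> ij; rewrite /dact -mactME fD0 // linear0 zero_lfunE. Qed.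

Lemma dact_sum X (x : X) : \sum_i dact i 1 x = x.
Proof.
rewrite /dact -[RHS]mactE1 -(fD1 (tmap T)) linear_sum sum_lfunE.
by [].
Qed.

Lemma dact_linl X i (x : X) : linear (fun c => dact i c x).
Proof. by move=> a c d; rewrite /dact !linearP /= add_lfunE scale_lfunE. Qed.

Lemma dact_linr X i (c : sD Sp i) : linear (@dact X i c).
Proof. by move=> a x y; rewrite /dact linearP. Qed.

Lemma dact1K X i (c : sD Sp i) (x : X) : dact i c (dact i 1 x) = dact i c x.
Proof. by rewrite -dactM mulr1. Qed.

Lemma dact1Kl X i (c : sD Sp i) (x : X) : dact i 1 (dact i c x) = dact i c x.
Proof. by rewrite -dactM mul1r. Qed.

Definition vertex_part X (U : {vspace X}) i : {vspace X} :=
  (mact X (DD i 1) @: U)%VS.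

Lemma vertex_partP X (U : {vspace X}) i x : submodule U ->
  reflect (x \in U /\ dact i 1 x = x) (x \in vertex_part U i).
Proof.
move/asboolP => hU; apply: (iffP memv_imgP) => [[y yU ->]|[xU xE]].
  by split; [apply: hU|apply: dact1Kl].
by exists x; rewrite // xE.
Qed.

Lemma submodule_full X : submodule (fullv : {vspace X}).
Proof. by apply/asboolP => a x _; apply: memvf. Qed.

Lemma submodule0 X : submodule (0%VS : {vspace X}).
Proof. by apply/asboolP => a x; rewrite memv0 => /eqP->; rewrite linear0 mem0v. Qed.

Lemma vertex_part_act X (U : {vspace X}) i : submodule U ->
  division_action {:sD Sp i} (@dact X i) (vertex_part U i).
Proof.
move=> sU; split.
- exact: dact_linl.
- exact: dact_linr.
- move=> c z _ /(vertex_partP _ _ sU)[zU _]; apply/(vertex_partP _ _ sU); split.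
    by move/asboolP: sU => hU; apply: hU.
  exact: dact1Kl.
- by move=> c d _ _; exists (c * d); rewrite ?memvf // => z _; rewrite dactM.
- by exists 1; rewrite ?memvf // => z /(vertex_partP _ _ sU)[].
- move=> c _ c0; exists c^-1; rewrite ?memvf // => z /(vertex_partP _ _ sU)[_ zE].
  by rewrite -dactM mulVf.
Qed.

Lemma dact_sub0 X i (c : sD Sp i) b : c \in fullv ->
  b \in (0%VS : {vspace X}) -> dact i c b \in (0%VS : {vspace X}).
Proof. by rewrite !memv0 => _ /eqP->; rewrite /dact linear0. Qed.

Lemma vertex_part_basis X (U : {vspace X}) i : submodule U ->
  exists r, dimvec_sub U i 0 = r%:Z /\ exists w : 'I_r -> X,
    is_dbasis {:sD Sp i} (@dact X i) (vertex_part U i) 0 w.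
Proof.
move=> sU; rewrite mxE; eexists; split; first reflexivity.
apply: (ddim_basis (vertex_part_act i sU)); first exact: sub0v.
by move=> c b; apply: dact_sub0.
Qed.

Lemma dim_vertex_part X (U : {vspace X}) i : submodule U ->
  (\dim (vertex_part U i))%:Z = dimvec_sub U i 0 * (vval Q i)%:Z.
Proof.
move=> sU; have [r [-> [w wP]]] := vertex_part_basis i sU.
have := dbasis_dim (vertex_part_act i sU) (sub0v _) wP.
by rewrite dimv0 addn0 dim_sD => ->; rewrite PoszM.
Qed.

Lemma fM_vertex i j (x : sM Sp i j) : MM i j x = DD j 1 * MM i j x * DD i 1.
Proof. by rewrite -fM_l -fM_r lactM1 ractM1. Qed.

Lemma bimodule_act i j :
  division_action {:sD Sp j} (@lactM _ _ _ Sp i j) fullv.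
Proof.
split.
- exact: lactM_linl.
- exact: lactM_linr.
- by move=> *; apply: memvf.
- by move=> c d _ _; exists (c * d); rewrite ?memvf // => z _; rewrite lactMM.
- by exists 1; rewrite ?memvf // => z _; rewrite lactM1.
- move=> c _ c0; exists c^-1; rewrite ?memvf // => z _.
  by rewrite -lactMM mulVf ?lactM1.
Qed.

Lemma bimodule_basis i j : exists w : 'I_(varr2 Q i j) -> sM Sp i j,
  is_dbasis {:sD Sp j} (@lactM _ _ _ Sp i j) fullv 0 w.
Proof.
rewrite -(dim_sMl Sp i j); apply: (ddim_basis (bimodule_act i j)).
  exact: sub0v.
move=> c b _; rewrite !memv0 => /eqP->.
have lc := @lactM_linr _ _ _ Sp i j c; apply/eqP.
by rewrite -(linfunE lc) linear0.
Qed.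

(** A D_i-basis of the vertex part e_i X with its coordinate functions, extended to X through the
    idempotent e_i. Bundling the data lets one choose it for all vertices at once. *)
Record vertex_coords X i := VertexCoords {
  vc_dim : nat;
  vc_basis : 'I_vc_dim -> X;
  vc_coord : X -> {ffun 'I_vc_dim -> sD Sp i};
  vc_dimE : dimvec X i 0 = vc_dim%:Z;
  vc_basisE : forall t, dact i 1 (vc_basis t) = vc_basis t;
  vc_linear : linear vc_coord;
  vc_coordE : forall x, dact i 1 x = \sum_t dact i (vc_coord x t) (vc_basis t);
  vc_coordU : forall x (c : {ffun 'I_vc_dim -> sD Sp i}),
    dact i 1 x = \sum_t dact i (c t) (vc_basis t) -> c = vc_coord x
}.

Arguments vc_basis [X i] v t.
Arguments vc_basisE [X i] v t.

Lemma vertex_coords_exist X i : inhabited (vertex_coords X i).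
Proof.
have sX := submodule_full X.
have [r [rE [w wP]]] := vertex_part_basis i sX.
have [||co [lin_co _ coE coU]] :=
  dbasis_coord (vertex_part_act i sX) (pi := @dact X i 1) _ _ wP.
- exact: dact_linr.
- by move=> x; apply/(vertex_partP _ _ sX); rewrite memvf dact1Kl.
have wE t : dact i 1 (w t) = w t by have /(vertex_partP _ _ sX)[] := wP.1 t.
constructor; apply: (VertexCoords rE wE lin_co coE) => x c.
by apply: coU => t; apply: memvf.
Qed.

Lemma vc_coordM X i (vc : vertex_coords X i) c x :
  vc_coord vc (dact i c x) = [ffun t => c * vc_coord vc x t].
Proof.
apply/esym/vc_coordU; rewrite dact1Kl -dact1K (vc_coordE vc).
rewrite -(linfunE (@dact_linr X i c)) linear_sum; apply: eq_bigr => t _.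
by rewrite ffunE dactM; apply: linfunE; apply: dact_linr.
Qed.

Lemma vc_coord0 X i (vc : vertex_coords X i) j c x :
  j != i -> vc_coord vc (dact j c x) = 0.
Proof.
move=> ji; apply/esym/vc_coordU; rewrite dact0 1?eq_sym //.
rewrite big1 // => t _; rewrite ffunE.
by rewrite -(linfunE (@dact_linl X i _)) linear0.
Qed.

Lemma vc_coord_basis X i (vc : vertex_coords X i) t :
  vc_coord vc (vc_basis vc t) = [ffun s => (s == t)%:R].
Proof.
apply/esym/vc_coordU; rewrite vc_basisE (bigD1 t) //= ffunE eqxx vc_basisE.
rewrite big1 ?addr0 // => s st; rewrite ffunE (negbTE st).
by rewrite -(linfunE (@dact_linl X i _)) linear0.
Qed.

Record arrow_coords i j := ArrowCoords {
  ac_basis : 'I_(varr2 Q i j) -> sM Sp i j;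
  ac_coord : sM Sp i j -> {ffun 'I_(varr2 Q i j) -> sD Sp j};
  ac_linear : linear ac_coord;
  ac_coordE : forall x, x = \sum_s lactM (ac_coord x s) (ac_basis s);
  ac_coordU : forall x (c : {ffun 'I_(varr2 Q i j) -> sD Sp j}),
    x = \sum_s lactM (c s) (ac_basis s) -> c = ac_coord x
}.

Arguments ac_basis [i j] a s.

Lemma arrow_coords_exist i j : inhabited (arrow_coords i j).
Proof.
have [w wP] := bimodule_basis i j.
have [||co [lin_co _ coE coU]] :=
  dbasis_coord (bimodule_act i j) (pi := idfun) _ _ wP.
- by [].
- by move=> x; apply: memvf.
constructor; apply: (ArrowCoords lin_co coE) => x c.
by apply: coU => t; apply: memvf.
Qed.

Lemma ac_coordM i j (ac : arrow_coords i j) c x :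
  ac_coord ac (lactM c x) = [ffun s => c * ac_coord ac x s].
Proof.
have lE := linfunE (@lactM_linr _ _ _ Sp i j c).
apply/esym/ac_coordU; rewrite {1}(ac_coordE ac x) -lE linear_sum.
by apply: eq_bigr => s _; rewrite ffunE lactMM -lE.
Qed.

Lemma ac_coord_basis i j (ac : arrow_coords i j) s :
  ac_coord ac (ac_basis ac s) = [ffun s' => (s' == s)%:R].
Proof.
apply/esym/ac_coordU; rewrite (bigD1 s) //= ffunE eqxx lactM1.
rewrite big1 ?addr0 // => s' st; rewrite ffunE (negbTE st).
by rewrite -(linfunE (@lactM_linl _ _ _ Sp i j _)) linear0.
Qed.

Lemma inhabited_family (J : Type) (F : J -> Type) :
  (forall j, inhabited (F j)) -> inhabited (forall j, F j).
Proof.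
by move=> H; constructor=> j; apply: (proj1_sig (cid (_ : exists x : F j, True)));
   case: (H j) => x; exists x.
Qed.

Section EulerForm.
Variables X Y : lmodA T.

Definition vhom (h : 'Hom(X, Y)) : Prop :=
  forall i c x, h (dact i c x) = dact i c (h x).

(** A map commuting with the vertices amounts to a free choice, for each basis vector of e_i X, of
    an image in e_i Y. *)
Lemma dim_vhom (U : {vspace 'Hom(X, Y)}) : (forall h, h \in U <-> vhom h) ->
  (\dim U)%:Z = \sum_i dimvec X i 0 * (dimvec Y i 0 * (vval Q i)%:Z).
Proof.
move=> UE.
have [vc] := inhabited_family (@vertex_coords_exist X).
have sY := submodule_full Y.
pose I := {i : 'I_m & 'I_(vc_dim (vc i))}.
pose tg i (t : 'I_(vc_dim (vc i))) : I := existT _ i t.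
pose f (h : 'Hom(X, Y)) : {ffun I -> Y} :=
  [ffun u : I => h (vc_basis (vc (tag u)) (tagged u))].
have -> : \dim U = \dim (ffun_vs (fun u : I => vertex_part (fullv : {vspace Y}) (tag u))).
  apply: (@dim_bij _ _ _ f).
  - by move=> c h h'; apply/ffunP => u; rewrite !ffunE add_lfunE scale_lfunE.
  - move=> h /UE hD; apply/ffun_vsP => -[i t]; rewrite ffunE /=.
    apply/(vertex_partP _ _ sY); split; first exact: memvf.
    by rewrite -hD vc_basisE.
  - move=> h /UE hD f0; apply/lfunP => x; rewrite zero_lfunE.
    rewrite -(dact_sum x) linear_sum big1 // => i _ /=.
    rewrite (vc_coordE (vc i)) linear_sum big1 // => t _ /=.
    rewrite hD; have := congr1 (fun g : {ffun I -> Y} => g (tg _ t)) f0.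
    by rewrite !ffunE /= => ->; rewrite /dact linear0.
  move=> w /ffun_vsP wY.
  pose h0 x := \sum_i \sum_t dact i (vc_coord (vc i) x t) (w (tg _ t)).
  have h0E : linfun h0 =1 h0.
    apply: linfunE => c x y; rewrite /h0 scaler_sumr -big_split; apply: eq_bigr => i _.
    rewrite scaler_sumr -big_split; apply: eq_bigr => t _ /=.
    by rewrite vc_linear !ffunE; apply: dact_linl.
  have wE i t : dact i 1 (w (tg i t)) = w (tg i t).
    by case/(vertex_partP _ _ sY): (wY (tg i t)) => _ wE; apply: wE.
  exists (linfun h0).
    apply/UE => i c x; rewrite !h0E /h0 (bigD1 i) //= [X in _ + X = _]big1
      ?addr0; last first.
      move=> j ji; rewrite big1 // => t _; rewrite vc_coord0 1?eq_sym // ffunE.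
      by rewrite -(linfunE (@dact_linl Y j _)) linear0.
    have lE := linfunE (@dact_linr Y i c).
    rewrite -lE linear_sum (bigD1 i) //= [X in _ + X]big1 ?addr0; last first.
      move=> j ji; rewrite linear_sum big1 // => t _ /=.
      by rewrite lE dact0 // eq_sym.
    rewrite linear_sum; apply: eq_bigr => t _ /=.
    by rewrite lE -dactM vc_coordM ffunE.
  apply/ffunP => -[i t]; rewrite ffunE h0E /h0 /= (bigD1 i) //=.
  rewrite [X in _ + X]big1 ?addr0; last first.
    move=> j ji; rewrite big1 // => s _; rewrite -(vc_basisE (vc i)).
    rewrite vc_coord0 1?eq_sym // ffunE.
    by rewrite -(linfunE (@dact_linl Y j _)) linear0.
  rewrite (bigD1 t) //= vc_coord_basis ffunE eqxx wE big1 ?addr0 // => s st.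
  by rewrite ffunE (negbTE st) -(linfunE (@dact_linl Y i _)) linear0.
rewrite dim_ffun_vs (sum_tag _ (fun i => \dim (vertex_part (fullv : {vspace Y}) i))).
rewrite (big_morph Posz PoszD (erefl _)); apply: eq_bigr => i _.
by rewrite PoszM card_ord -vc_dimE dim_vertex_part.
Qed.

Definition vertex_derivation (dl : 'Hom(T, 'Hom(X, Y))) : Prop :=
  dl \in ext_Z X Y /\ forall i c, dl (DD i c) = 0.

Lemma vertex_derivation_l dl i j c x z : vertex_derivation dl ->
  dl (MM i j (lactM c x)) z = dact j c (dl (MM i j x) z).
Proof.
by case=> /ext_ZP dlM dl0; rewrite fM_l dlM dl0 zero_lfunE addr0.
Qed.

Lemma vertex_derivation_r dl i j c x z : vertex_derivation dl ->
  dl (MM i j (ractM x c)) z = dl (MM i j x) (dact i c z).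
Proof.
by case=> /ext_ZP dlM dl0; rewrite fM_r dlM dl0 zero_lfunE linear0 add0r.
Qed.

(** Such a derivation is a bimodule map on the arrows. It amounts to a free choice, for each left
    basis element of M_ij and each basis vector of e_i X, of a value in e_j Y. *)
Lemma dim_vertex_derivation (U : {vspace 'Hom(T, 'Hom(X, Y))}) :
    (forall dl, dl \in U <-> vertex_derivation dl) ->
  (\dim U)%:Z = \sum_i \sum_j
    (varr2 Q i j)%:Z * dimvec X i 0 * (dimvec Y j 0 * (vval Q j)%:Z).
Proof.
move=> UE.
have [vc] := inhabited_family (@vertex_coords_exist X).
have [ac] := inhabited_family
  (fun ij : 'I_m * 'I_m => arrow_coords_exist ij.1 ij.2).
have sY := submodule_full Y.
pose J (ij : 'I_m * 'I_m) := ('I_(varr2 Q ij.1 ij.2) * 'I_(vc_dim (vc ij.1)))%type.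
pose I := {ij : 'I_m * 'I_m & J ij}.
pose tg i j s t : I := existT J (i, j) (s, t).
pose f (dl : 'Hom(T, 'Hom(X, Y))) : {ffun I -> Y} :=
  [ffun u : I => dl (MM _ _ (ac_basis (ac (tag u)) (tagged u).1))
                    (vc_basis (vc (tag u).1) (tagged u).2)].
have -> : \dim U =
    \dim (ffun_vs (fun u : I => vertex_part (fullv : {vspace Y}) (tag u).2)).
  apply: (@dim_bij _ _ _ f).
  - by move=> c h h'; apply/ffunP => u; rewrite !ffunE !(add_lfunE, scale_lfunE).
  - move=> dl /UE dlU; apply/ffun_vsP => -[[i j] [s t]]; rewrite ffunE /=.
    apply/(vertex_partP _ _ sY); split; first exact: memvf.
    by rewrite -(vertex_derivation_l _ _ _ dlU) lactM1.
  - move=> dl /UE dlU f0; apply: (ext_Z_unique dlU.1 dlU.2) => i j x.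
    apply/lfunP => z; rewrite zero_lfunE.
    rewrite -[x]ractM1 vertex_derivation_r // (vc_coordE (vc i)).
    rewrite linear_sum big1 // => t _ /=.
    rewrite -vertex_derivation_r // (ac_coordE (ac (i, j)) (ractM _ _)).
    rewrite !linear_sum sum_lfunE big1 // => s _ /=.
    rewrite vertex_derivation_l //.
    have := congr1 (fun g : {ffun I -> Y} => g (tg i j s t)) f0.
    by rewrite !ffunE /= => ->; rewrite /dact linear0.
  move=> w /ffun_vsP wY.
  have wE i j s t : dact j 1 (w (tg i j s t)) = w (tg i j s t).
    by case/(vertex_partP _ _ sY): (wY (tg i j s t)) => _ wE; apply: wE.
  (* The coefficients of z over D_i are first moved onto x by the right action; only then is x
     expanded over D_j. This makes the formula compatible with both actions. *)
  pose h0 i j x z := \sum_t \sum_s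
    dact j (ac_coord (ac (i, j)) (ractM x (vc_coord (vc i) z t)) s) (w (tg i j s t)).
  have h0E i j x : linfun (h0 i j x) =1 h0 i j x.
    apply: linfunE => c y z; rewrite /h0 scaler_sumr -big_split; apply: eq_bigr => t _.
    rewrite scaler_sumr -big_split; apply: eq_bigr => s _ /=.
    rewrite vc_linear !ffunE ractM_linr ac_linear !ffunE; exact: dact_linl.
  have [|||dl [dlZ dlD dlM]] :=
    @ext_Z_exists _ _ _ _ T X Y (fun i j x => linfun (h0 i j x)).
  - move=> i j c x y; apply/lfunP => z; rewrite add_lfunE scale_lfunE !h0E /h0.
    rewrite scaler_sumr -big_split; apply: eq_bigr => t _.
    rewrite scaler_sumr -big_split; apply: eq_bigr => s _ /=.
    rewrite ractM_linl ac_linear !ffunE; exact: dact_linl.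
  - move=> i j c x; apply/lfunP => z; rewrite comp_lfunE !h0E /h0.
    rewrite linear_sum; apply: eq_bigr => t _.
    rewrite linear_sum; apply: eq_bigr => s _ /=.
    by rewrite lractM ac_coordM ffunE dactM.
  - move=> i j c x; apply/lfunP => z; rewrite comp_lfunE !h0E /h0.
    apply: eq_bigr => t _; apply: eq_bigr => s _ /=.
    by rewrite -/(dact i c z) vc_coordM ffunE ractMM.
  exists dl; first by apply/UE.
  apply/ffunP => -[[i j] [s t]]; rewrite ffunE dlM h0E /h0 /=.
  rewrite (bigD1 t) //= [X in _ + X]big1 ?addr0; last first.
    move=> t' tt; rewrite big1 // => s' _.
    rewrite vc_coord_basis ffunE (negbTE tt).
    have lE := linfunE (@ractM_linr _ _ _ Sp i j (ac_basis (ac (i, j)) s)).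
    rewrite -lE linear0 -(linfunE (ac_linear (ac (i, j)))) linear0 ffunE.
    by rewrite -(linfunE (@dact_linl Y j _)) linear0.
  rewrite vc_coord_basis ffunE eqxx ractM1 (bigD1 s) //= ac_coord_basis.
  rewrite ffunE eqxx wE big1 ?addr0 // => s' st.
  by rewrite ffunE (negbTE st) -(linfunE (@dact_linl Y j _)) linear0.
rewrite dim_ffun_vs (sum_tag _ (fun ij => \dim (vertex_part (fullv : {vspace Y}) ij.2))).
rewrite (big_morph Posz PoszD (erefl _)) pair_big; apply: eq_bigr => -[i j] _ /=.
by rewrite PoszM card_prod !card_ord PoszM -vc_dimE dim_vertex_part.
Qed.
End EulerForm.
End DimensionVectors.

Arguments dact {k m Q Sp T X} i c x.

(** * The Euler form *)

(** The order of F vanishes in k, so the number of units of F is -1 there. *)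
Lemma sum_field_units (k : finFieldType) (F : fieldExtType k) (V : lmodType k) (v : V) :
  \sum_(u : finvect_type F | u != 0) v = - v.
Proof.
have card0 : #|finvect_type F|%:R = 0 :> k.
  have : (#|finvect_type F|%:R : F) = 0.
    have : \sum_(u : finvect_type F) u = \sum_(u : finvect_type F) (u + 1).
      by rewrite (reindex_inj (addIr 1)).
    rewrite big_split /= sumr_const
      => /(congr1 (fun z => z - \sum_(u : finvect_type F) u)).
    by rewrite subrr addrAC subrr add0r.
  rewrite -scaler_nat => /eqP.
  by rewrite scaler_eq0 oner_eq0 orbF => /eqP.
apply/eqP; rewrite -addr_eq0 addrC; apply/eqP.
transitivity (\sum_(u : finvect_type F) v); first by rewrite [RHS](bigD1 0).
by rewrite sumr_const -scaler_nat card0 scale0r.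
Qed.

Section EulerForm.
Variables (k : finFieldType) (m : nat) (Q : vquiver m) (Sp : species k Q).
Variable (T : tensor_algebra Sp).
Implicit Types X Y : lmodA T.
Local Notation DD := (fD (tmap T)).
Local Notation MM := (fM (tmap T)).

(* The element \sum_i \sum_u u (x) u^-1, with u in the units of D_i, commutes *)
(* with every D_i and multiplies to -1: it is a separability element.        *)
Lemma derivation_vertex_inner X Y (dl : 'Hom(T, 'Hom(X, Y))) : dl \in ext_Z X Y ->
  exists h : 'Hom(X, Y), forall i c x,
    dl (DD i c) x = h (dact i c x) - dact i c (h x).
Proof.
move/ext_ZP => dlM.
pose s i : 'Hom(X, Y) := \sum_(u : finvect_type (sD Sp i) | u != 0)
  (dl (DD i u) \o mact X (DD i (u : sD Sp i)^-1%R))%VF.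
have sE i z : s i z = \sum_(u : finvect_type (sD Sp i) | u != 0)
    dl (DD i u) (dact i (u : sD Sp i)^-1 z).
  by rewrite sum_lfunE; apply: eq_bigr => u _; rewrite comp_lfunE.
(* The Leibniz rule expresses c dl(u) through dl(cu), and the substitution of cu for u cancels the
   main terms when i = j. The leftover dl(c) e_i z is the same for every unit u, so it is counted -1
   times. *)
have sP i j c z : s i (dact j c z) - dact j c (s i z) = - dl (DD j c) (dact i 1 z).
  have [->|c0] := eqVneq c 0.
    rewrite /dact !linear0 !zero_lfunE linear0 !(linear0, zero_lfunE).
    by rewrite ?oppr0 ?addr0.
  set v := dl (DD j c) _; rewrite -(sum_field_units (sD Sp i) v).
  have -> : dact j c (s i z) = \sum_(u : finvect_type (sD Sp i) | u != 0)
      (dl (DD j c * DD i u) (dact i (u : sD Sp i)^-1 z) - v).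
    rewrite sE /dact linear_sum; apply: eq_bigr => u u0 /=.
    have uK : mact X (DD i u) (dact i (u : sD Sp i)^-1 z) = dact i 1 z.
      by rewrite -[LHS]/(dact i u _) -dactM mulfV.
    by rewrite dlM uK addrK.
  rewrite sumrB opprB addrC -[RHS]addr0 -addrA; congr (_ + _).
  rewrite addrC; apply/eqP; rewrite subr_eq0; apply/eqP; rewrite sE.
  have [ij|ij] := eqVneq i j; last first.
    rewrite !big1 // => u u0; first by rewrite fD0 1?eq_sym // linear0 zero_lfunE.
    by rewrite dact0 // linear0.
  case: _ / ij c c0 @v => c c0 _.
  pose F := finvect_type (sD Sp i).
  rewrite (reindex_inj (@mulfI F c c0)); apply: eq_big => [u|u u0].
    by rewrite mulf_eq0 (negbTE c0).
  by rewrite -dactM fDM invfM mulrAC mulVf ?mul1r.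
exists (- \sum_i s i) => j c z.
have dN : dact j c (- \sum_i s i z) = - \sum_i dact j c (s i z).
  by rewrite /dact linearN linear_sum.
rewrite !opp_lfunE !sum_lfunE dN opprK addrC -sumrB.
transitivity (\sum_i dl (DD j c) (dact i 1 z)).
  by rewrite -linear_sum dact_sum.
apply: eq_bigr => i _; rewrite -[LHS]opprK -sP opprB.
by [].
Qed.

(* The inner derivations complement those vanishing on the vertices, up to    *)
(* the inner derivations by maps commuting with the vertices.                *)
Lemma hom_sub_ext X Y : (hom_dim X Y)%:Z - (ext_dim X Y)%:Z =
  \sum_i dimvec X i 0 * (dimvec Y i 0 * (vval Q i)%:Z) -
  \sum_i \sum_j (varr2 Q i j)%:Z * dimvec X i 0 * (dimvec Y j 0 * (vval Q j)%:Z).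
Proof.
have [H0 H0E] : exists U : {vspace 'Hom(X, Y)}, forall h, h \in U <-> vhom h.
  apply: vspace_of_pred => [i c x|c g h gV hV i d x].
    by rewrite !zero_lfunE /dact linear0.
  by rewrite !add_lfunE !scale_lfunE gV hV /dact linearP.
have [Z0 Z0E] : exists U : {vspace 'Hom(T, 'Hom(X, Y))},
    forall dl, dl \in U <-> vertex_derivation dl.
  apply: vspace_of_pred => [|c d d' [dZ d0] [dZ' d0']].
    by split=> [|i c]; rewrite ?mem0v ?zero_lfunE.
  split=> [|i a]; first by rewrite rpredD ?rpredZ.
  by rewrite add_lfunE scale_lfunE d0 d0' scaler0 addr0.
rewrite -(dim_vhom H0E) -(dim_vertex_derivation Z0E).
pose ad := linfun (@hom_defect _ _ X Y).
have adE h a x : ad h a x = h (mact X a x) - mact Y a (h x).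
  by rewrite lfunE /= hom_defectE !(add_lfunE, opp_lfunE, comp_lfunE).
have homH0 : (homA X Y <= H0)%VS.
  by apply/subvP => h /homAP hA; apply/H0E => i c x; apply: hA.
have dimB := limg_ker_dim ad fullv.
have dimH := limg_ker_dim ad H0.
have BZ := dimvS (ext_B_sub X Y).
have Z0Z : (Z0 <= ext_Z X Y)%VS by apply/subvP => dl /Z0E[].
have ZE : (Z0 + ext_B X Y)%VS = ext_Z X Y.
  apply/eqP; rewrite eqEsubv subv_add Z0Z ext_B_sub /=; apply/subvP => dl dlZ.
  have [h hE] := derivation_vertex_inner dlZ.
  have adB : ad h \in ext_B X Y by rewrite memv_img ?memvf.
  rewrite -[dl](subrK (ad h)) memv_add //; apply/Z0E; split.
    by rewrite rpredB // (subvP (ext_B_sub X Y)).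
  move=> i c; apply/lfunP => x.
  by rewrite !(add_lfunE, opp_lfunE) adE hE subrr zero_lfunE.
have capE : (Z0 :&: ext_B X Y)%VS = (ad @: H0)%VS.
  apply/vspaceP => dl; rewrite memv_cap; apply/andP/memv_imgP.
    case=> /Z0E[_ dl0] /memv_imgP[h _ dlE]; exists h => //.
    apply/H0E => i c x; apply/eqP; rewrite -subr_eq0 -adE.
    by rewrite -[ad h]dlE dl0 zero_lfunE.
  case=> h /H0E hV ->; split; last by rewrite memv_img ?memvf.
  apply/Z0E; split; first by rewrite (subvP (ext_B_sub X Y)) // memv_img ?memvf.
  by move=> i c; apply/lfunP => x; rewrite adE hV subrr zero_lfunE.
have := dimv_sum_cap Z0 (ext_B X Y); rewrite ZE capE.
move: dimB dimH; rewrite capfv (capv_idPr homH0).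
have arith (a b v h ah z z0 : nat) : (b <= z)%N -> (a + b = v)%N -> (a + ah = h)%N ->
  (z + ah = z0 + b)%N -> a%:Z - (z - b)%N%:Z = h%:Z - z0%:Z by lia.
exact: arith.
Qed.

(** Since [euler_gram] is picked by choice, a Gram matrix has to be exhibited; its entries are read
    off from [hom_sub_ext], vertices giving the diagonal part and arrows the rest. *)
Lemma euler_gramP X Y :
  euler T (dimvec X) (dimvec Y) = (hom_dim X Y)%:Z - (ext_dim X Y)%:Z.
Proof.
rewrite /euler /euler_gram; set P := fun C : 'M[int]_m => _.
suff [C PC] : exists C, P C by have := xgetPex 0 (ex_intro P C PC); apply.
exists (\matrix_(i, j) ((i == j)%:R * (vval Q j)%:Z - (varr2 Q i j)%:Z * (vval Q j)%:Z)).
move=> X' Y'; rewrite hom_sub_ext; move: (dimvec X') (dimvec Y') => x y.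
rewrite !mxE -sumrB.
under eq_bigr do rewrite mxE.
under eq_bigr do rewrite mulr_suml.
rewrite exchange_big; apply: eq_bigr => i _ /=.
under eq_bigr do rewrite !mxE mulrBr mulrBl.
rewrite sumrB; congr (_ - _); last by apply: eq_bigr => j _; ring.
rewrite (bigD1 i) //= eqxx big1 ?addr0 => [|j ji]; first by rewrite mul1r; ring.
by rewrite eq_sym (negbTE ji) mul0r mulr0 mul0r.
Qed.
End EulerForm.

(** * Simple modules *)

Section DivisionDimensions.
Variables (k : fieldType) (A : falgType k).
Implicit Types M N : lmodA A.

Lemma End_division_inv N (c : 'End(N)) : End_division N ->
  c \in homA N N -> c != 0 ->
  exists2 d, d \in homA N N & (d \o c)%VF = \1%VF /\ (c \o d)%VF = \1%VF.
Proof. by move=> [_ divN] cA /(divN _ cA)[_ [d dA dc]]; exists d. Qed.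

(** This lemma and its three companions convert dimensions over an endomorphism algebra into
    k-dimensions, where left and right counts can be compared. *)
Lemma hom_ldim_dim M N : End_division N ->
  hom_dim M N = (hom_ldim M N * hom_dim N N)%N.
Proof.
move=> divN; suff : \dim (homA M N) = (hom_ldim M N * \dim (homA N N) +
    \dim (0%VS : {vspace 'Hom(M, N)}))%N by rewrite dimv0 addn0.
apply: ddim_dim; last 2 first.
- exact: sub0v.
- by move=> c b _; rewrite !memv0 => /eqP->; rewrite comp_lfun0r.
split.
- by move=> h a c d; rewrite comp_lfunDl -comp_lfunZl.
- by move=> c a h g; rewrite comp_lfunDr -comp_lfunZr.
- by move=> c h; apply: comp_homA.
- move=> c d cA dA; exists (c \o d)%VF; first exact: comp_homA.
  by move=> h _; rewrite comp_lfunA.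
- by exists \1%VF => [|h _]; rewrite ?id_homA ?comp_lfun1l.
- move=> c cA /(End_division_inv divN cA)[d dA [dc _]]; exists d => // h _.
  by rewrite comp_lfunA dc comp_lfun1l.
Qed.

Lemma hom_rdim_dim M N : End_division M ->
  hom_dim M N = (hom_rdim M N * hom_dim M M)%N.
Proof.
move=> divM; suff : \dim (homA M N) = (hom_rdim M N * \dim (homA M M) +
    \dim (0%VS : {vspace 'Hom(M, N)}))%N by rewrite dimv0 addn0.
apply: ddim_dim; last 2 first.
- exact: sub0v.
- by move=> c b _; rewrite !memv0 => /eqP->; rewrite comp_lfun0l.
split.
- by move=> h a c d; rewrite comp_lfunDr -comp_lfunZr.
- by move=> c a h g; rewrite comp_lfunDl -comp_lfunZl.
- by move=> c h cA hA; apply: comp_homA.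
- move=> c d cA dA; exists (d \o c)%VF; first exact: comp_homA.
  by move=> h _; rewrite comp_lfunA.
- by exists \1%VF => [|h _]; rewrite ?id_homA ?comp_lfun1r.
- move=> c cA /(End_division_inv divM cA)[d dA [_ cd]]; exists d => // h _.
  by rewrite -comp_lfunA cd comp_lfun1r.
Qed.

Section ExtAction.
Variables M N : lmodA A.

Lemma ext_lactE (c : 'End(N)) (dl : 'Hom(A, 'Hom(M, N))) a x :
  linfun (fun a => (c \o dl a)%VF) a x = c (dl a x).
Proof.
rewrite linfunE ?comp_lfunE // => b a' a''.
by rewrite linearP comp_lfunDr -comp_lfunZr.
Qed.

Lemma ext_ractE (c : 'End(M)) (dl : 'Hom(A, 'Hom(M, N))) a x :
  linfun (fun a => (dl a \o c)%VF) a x = dl a (c x).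
Proof.
rewrite linfunE ?comp_lfunE // => b a' a''.
by rewrite linearP comp_lfunDl -comp_lfunZl.
Qed.

Lemma ext_ldim_dim : End_division N ->
  ext_dim M N = (ext_ldim M N * hom_dim N N)%N.
Proof.
move=> divN; apply: (canLR (addnK _)); apply: ddim_dim; last 2 first.
- exact: ext_B_sub.
- move=> c dl /homAP cA /ext_BP[h hE]; apply/ext_BP; exists (c \o h)%VF => a x.
  by rewrite ext_lactE hE linearB /= !comp_lfunE cA.
split.
- move=> h a c d; apply/lfunP => b; apply/lfunP => x.
  by rewrite !(add_lfunE, scale_lfunE) !ext_lactE add_lfunE scale_lfunE.
- move=> c a h g; apply/lfunP => b; apply/lfunP => x.
  by rewrite !(add_lfunE, scale_lfunE) !ext_lactE !(add_lfunE, scale_lfunE) linearP.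
- move=> c dl /homAP cA /ext_ZP dlM; apply/ext_ZP => a b x.
  by rewrite !ext_lactE dlM linearD /= cA.
- move=> c d cA dA; exists (c \o d)%VF; first exact: comp_homA.
  move=> dl _; apply/lfunP => a; apply/lfunP => x.
  by rewrite !ext_lactE comp_lfunE.
- exists \1%VF => [|dl _]; first exact: id_homA.
  by apply/lfunP => a; apply/lfunP => x; rewrite ext_lactE id_lfunE.
- move=> c cA /(End_division_inv divN cA)[d dA [dc _]]; exists d => // dl _.
  apply/lfunP => a; apply/lfunP => x.
  by rewrite !ext_lactE -comp_lfunE dc id_lfunE.
Qed.

Lemma ext_rdim_dim : End_division M ->
  ext_dim M N = (ext_rdim M N * hom_dim M M)%N.
Proof.
move=> divM; apply: (canLR (addnK _)); apply: ddim_dim; last 2 first.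
- exact: ext_B_sub.
- move=> c dl /homAP cA /ext_BP[h hE]; apply/ext_BP; exists (h \o c)%VF => a x.
  by rewrite ext_ractE hE !comp_lfunE cA.
split.
- move=> h a c d; apply/lfunP => b; apply/lfunP => x.
  rewrite !(add_lfunE, scale_lfunE) !ext_ractE add_lfunE scale_lfunE.
  by rewrite linearP.
- move=> c a h g; apply/lfunP => b; apply/lfunP => x.
  by rewrite !(add_lfunE, scale_lfunE) !ext_ractE !(add_lfunE, scale_lfunE).
- move=> c dl /homAP cA /ext_ZP dlM; apply/ext_ZP => a b x.
  by rewrite !ext_ractE dlM /= cA.
- move=> c d cA dA; exists (d \o c)%VF; first exact: comp_homA.
  move=> dl _; apply/lfunP => a; apply/lfunP => x.
  by rewrite !ext_ractE comp_lfunE.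
- exists \1%VF => [|dl _]; first exact: id_homA.
  by apply/lfunP => a; apply/lfunP => x; rewrite ext_ractE id_lfunE.
- move=> c cA /(End_division_inv divM cA)[d dA [_ cd]]; exists d => // dl _.
  apply/lfunP => a; apply/lfunP => x.
  by rewrite !ext_ractE -[c (d x)]comp_lfunE cd id_lfunE.
Qed.
End ExtAction.
End DivisionDimensions.

(** Take j in [p] reaching the fewest vertices of [p]: the target in [p] of an arrow from j would
    reach fewer, since reaching j again would close a cycle. *)
Lemma acyclic_sink m (Q : vquiver m) (p : pred 'I_m) i : acyclic Q -> p i ->
  exists2 j, p j & forall l, p l -> ~~ arrow Q j l.
Proof.
move=> acyQ pi; pose reach j := #|[set l | p l & connect (arrow Q) j l]|.
case: (arg_minnP reach pi) => j pj minj; exists j => // l pl.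
apply/negP => jl; have := minj l pl.
rewrite leqNgt => /negP; apply; apply: proper_card; apply/properP; split.
  apply/fintype.subsetP => s; rewrite !inE => /andP[-> ls].
  exact: connect_trans (connect1 jl) ls.
exists j; first by rewrite inE pj connect0.
rewrite inE pj; apply/negP => /connectP[s ls jE].
have /acyQ// : cycle (arrow Q) (l :: s) by rewrite /= rcons_path ls -jE.
Qed.

(** * Structure of the simple modules and the Gram matrix of the Euler form *)

Section Simples.
Variables (k : finFieldType) (m : nat) (Q : vquiver m) (Sp : species k Q).
Variable (T : tensor_algebra Sp).
Hypothesis acyQ : acyclic Q.
Implicit Types X Y : lmodA T.
Local Notation DD := (fD (tmap T)).
Local Notation MM := (fM (tmap T)).
Local Notation dact := (@dact _ _ _ _ T _).

Lemma submodule_gen X (U : {vspace X}) :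
    (forall i c x, x \in U -> dact i c x \in U) ->
    (forall i j s x, x \in U -> mact X (MM i j s) x \in U) -> submodule U.
Proof.
move=> UD UM; apply/asboolP => a.
suff : a \in [pred b | `[< forall x, x \in U -> mact X b x \in U >]].
  by move=> /asboolP aU; apply: aU.
apply: tensor_algebra_gen.
- split; first by apply/asboolP => x xU; rewrite mactE1.
  + move=> c b b' /asboolP bU /asboolP bU'; apply/asboolP => x xU.
    by rewrite linearP /= add_lfunE scale_lfunE rpredD ?rpredZ ?bU ?bU'.
  + move=> b b' /asboolP bU /asboolP bU'; apply/asboolP => x xU.
    by rewrite mactME bU ?bU'.
- by move=> i c; apply/asboolP => x; apply: UD.
- by move=> i j s; apply/asboolP => x; apply: UM.
Qed.

Lemma homA_gen X Y (h : 'Hom(X, Y)) : vhom h ->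
  (forall i j s x, h (mact X (MM i j s) x) = mact Y (MM i j s) (h x)) -> h \in homA X Y.
Proof.
move=> hD hM; rewrite memv_ker lfunE /=; apply/eqP/ext_Z_unique.
- by apply: (subvP (ext_B_sub X Y)); rewrite -[hom_defect h]lfunE memv_img ?memvf.
- move=> i c; apply/lfunP => x; rewrite hom_defectE.
  by rewrite !(add_lfunE, opp_lfunE, comp_lfunE) hD zero_lfunE subrr.
- move=> i j s; apply/lfunP => x; rewrite hom_defectE.
  by rewrite !(add_lfunE, opp_lfunE, comp_lfunE) hM zero_lfunE subrr.
Qed.

Lemma no_arrow_bimodule i j (s : sM Sp i j) : ~~ arrow Q i j -> s = 0.
Proof.
rewrite /arrow negbK => /eqP v0.
have v2 : varr2 Q i j = 0%N.
  have := varr_sym Q i j; rewrite v0 mul0n => /esym/eqP.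
  by rewrite muln_eq0 => /orP[/eqP//|]; rewrite eqn0Ngt vval_gt0.
have [ac] := arrow_coords_exist Sp i j.
rewrite (ac_coordE ac s) big1 // => t _; case: t => t lt_t; exfalso.
by rewrite v2 in lt_t.
Qed.

(** Choose a sink j of the support of X and a nonzero [x0] in e_j X. All arrows from j leave the
    support, so D_j [x0] is a nonzero submodule, hence X itself, and j must be i. *)
Lemma simple_at_line i X : simple_at i X ->
  exists x0 : X, [/\ x0 != 0, forall y, exists c : sD Sp i, y = dact i c x0,
    forall j (c : sD Sp j) (y : X), j != i -> dact j c y = 0 &
    forall a b s y, mact X (MM a b s) y = 0].
Proof.
case=> [[dimX simX] ei].
have sX := submodule_full X.
have ei' : vertex_part (fullv : {vspace X}) i != 0%VS.
  apply: contraNneq ei => e0; apply/eqP/lfunP => x; rewrite zero_lfunE.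
  by apply/eqP; rewrite -memv0 -e0 memv_img ?memvf.
have [j ej jsink] := acyclic_sink
  (p := fun i => vertex_part (fullv : {vspace X}) i != 0%VS) acyQ ei'.
pose x0 := vpick (vertex_part (fullv : {vspace X}) j).
have x00 : x0 != 0 by rewrite vpick0.
have /(vertex_partP _ _ sX)[_ x0E] : x0 \in vertex_part fullv j by apply: memv_pick.
have lE := linfunE (@dact_linl _ _ _ _ T X j x0).
pose U := limg (linfun (fun c : sD Sp j => dact j c x0)).
have UP y : reflect (exists c : sD Sp j, y = dact j c x0) (y \in U).
  apply: (iffP memv_imgP) => [[c _ ->]|[c ->]]; exists c; rewrite ?lE //.
  exact: memvf.
have actU l c y : l != j -> y \in U -> dact l c y = 0.
  by move=> lj /UP[d ->]; rewrite dact0.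
have arrU a b s y : y \in U -> mact X (MM a b s) y = 0.
  move=> yU; rewrite fM_vertex mactME.
  have [aj|aj] := eqVneq a j; last first.
    by rewrite -[mact X (DD a 1) y]/(dact a 1 y) actU // linear0.
  have [jb|/no_arrow_bimodule s0] := boolP (arrow Q a b); last first.
    have MM0 : MM a b s = 0 by rewrite (s0 s) linear0.
    by rewrite MM0 mulr0 linear0 zero_lfunE.
  rewrite mactME; apply/eqP; rewrite -memv0.
  have /eqP <- : vertex_part (fullv : {vspace X}) b == 0%VS.
    by apply: contraLR jb => pb; rewrite aj; apply: jsink.
  by rewrite memv_img ?memvf.
have sU : submodule U.
  apply: submodule_gen => [l c y yU|a b s y yU]; last by rewrite arrU ?mem0v.
  have [lj|lj] := eqVneq l j; last by rewrite (actU _ _ _ lj yU) mem0v.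
  case: _ / (esym lj) c => c; case/UP: yU => d ->; apply/UP.
  by exists (c * d); rewrite dactM.
have x0U : x0 \in U by apply/UP; exists 1; rewrite x0E.
have Ufull : U = fullv.
  by case: (simX U sU) => // U0; move: x0U x00; rewrite U0 memv0 => ->.
have ij : i = j.
  apply/eqP; apply: contraNT ei => ij; apply/eqP/lfunP => y; rewrite zero_lfunE.
  by apply: (actU i 1 y ij); rewrite Ufull memvf.
rewrite {i ei ei'}ij; exists x0; split=> //.
- by move=> y; apply/UP; rewrite Ufull memvf.
- by move=> l c y lj; apply: (actU l c y lj); rewrite Ufull memvf.
- by move=> a b s y; apply: arrU; rewrite Ufull memvf.
Qed.

Lemma simple_at_actM i X (c : sD Sp i) : simple_at i X -> mact X (DD i c) \in homA X X.
Proof.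
case/simple_at_line => x0 [_ line act0 arr0];
  apply: homA_gen => [j d x|a b s x]; last first.
  by rewrite !arr0 linear0.
have [ji|ji] := eqVneq j i; last by rewrite !act0 ?linear0.
case: _ / (esym ji) d => d; rewrite -/(dact i c _) -/(dact i c x) -!dactM.
by rewrite mulrC.
Qed.

(** An endomorphism is determined by the image c [x0] of the generator, and it is multiplication by
    c because D_i is commutative. *)
Lemma simple_at_End_division i X : simple_at i X -> End_division X.
Proof.
move=> sim; have [x0 [x00 line act0 arr0]] := simple_at_line sim.
have lE := linfunE (@dact_linl _ _ _ _ T X i x0).
split; first by case: sim => -[].
move=> h hA h0; split=> //; have [c cE] := line (h x0).
have hE : h = mact X (DD i c).
  apply/lfunP => y; have [d ->] := line y.
  move/homAP: hA => ->; rewrite cE -/(dact i d _) -/(dact i c _) -!dactM.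
  by rewrite mulrC.
have c0 : c != 0.
  by apply: contraNneq h0 => c0; rewrite hE c0 !linear0.
exists (mact X (DD i c^-1)); first exact: simple_at_actM.
rewrite hE -!mactM -!fDM mulVf // mulfV //.
suff -> : mact X (DD i 1) = \1%VF by [].
apply/lfunP => y; have [d ->] := line y.
by rewrite -/(dact i 1 _) dact1Kl id_lfunE.
Qed.

Lemma dim_simple_at i X : simple_at i X -> \dim {:X} = vval Q i.
Proof.
case/simple_at_line => x0 [x00 line act0 arr0].
rewrite -(dim_sD Sp i); apply/esym.
apply: (@dim_bij _ _ _ (fun c : sD Sp i => dact i c x0)).
- exact: dact_linl.
- by move=> c _; apply: memvf.
- move=> c _ c0; apply/eqP; apply: contraNT x00 => cn0.
  have [d x0d] := line x0.
  by rewrite x0d -[d](divfK cn0) dactM c0 /dact linear0.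
- by move=> y _; have [c ->] := line y; exists c; rewrite ?memvf.
Qed.

Lemma simple_at_act1 i j X x : simple_at i X -> dact j 1 x = (i == j)%:R *: x :> X.
Proof.
case/simple_at_line => x0 [_ line act0 _].
have [<-|ij] := eqVneq i j; last by rewrite act0 1?eq_sym // scale0r.
by have [c ->] := line x; rewrite dact1Kl scale1r.
Qed.

Lemma dimvec_simple_at i X : simple_at i X -> dimvec X = delta_mx i 0.
Proof.
move=> sim; apply/colP => j; rewrite [RHS]mxE eqxx andbT eq_sym.
have := dim_vertex_part j (submodule_full X).
have d0 : (vval Q j)%:Z != 0 by have := vval_gt0 Q j; lia.
have -> : vertex_part (fullv : {vspace X}) j = if i == j then fullv else 0%VS.
  apply/vspaceP => x; apply/(vertex_partP _ _ (submodule_full X))/idP.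
    case=> _; rewrite (simple_at_act1 _ _ sim).
    by case: eqP => _; rewrite ?memvf // scale0r => <-; rewrite mem0v.
  rewrite (simple_at_act1 _ _ sim); case: eqP => _.
    by rewrite scale1r.
  by rewrite memv0 => /eqP->; rewrite scaler0 mem0v.
have [ij|_] := eqVneq i j; last first.
  by rewrite dimv0 => /esym/eqP; rewrite mulf_eq0 (negbTE d0) orbF => /eqP.
rewrite -ij in d0 *; rewrite (dim_simple_at sim) -[X in X = _]mul1r.
by move/(mulIf d0)/esym.
Qed.

Lemma hom_dim_simple_at_neq i j X Y : simple_at i X -> simple_at j Y ->
  i != j -> hom_dim X Y = 0%N.
Proof.
move=> simX simY ij; rewrite /hom_dim; suff -> : homA X Y = 0%VS by rewrite dimv0.
apply/eqP; rewrite -subv0; apply/subvP => h /homAP hA; rewrite memv0.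
apply/eqP/lfunP => x; rewrite zero_lfunE.
have xE : x = dact i 1 x by rewrite (simple_at_act1 _ _ simX) eqxx scale1r.
rewrite xE hA -[LHS]/(dact i 1 (h x)) (simple_at_act1 _ _ simY).
by rewrite eq_sym (negbTE ij) scale0r.
Qed.

Lemma hom_dim_simple_at i X : simple_at i X -> hom_dim X X = vval Q i.
Proof.
move=> sim; rewrite -(dim_simple_at sim).
have [x0 [x00 line act0 arr0]] := simple_at_line sim.
apply: (@dim_bij _ _ _ (fun h : 'End(X) => h x0)).
- by move=> c h h'; rewrite add_lfunE scale_lfunE.
- by move=> h _; apply: memvf.
- move=> h /homAP hA h0; apply/lfunP => y; have [c ->] := line y.
  by rewrite hA h0 linear0 zero_lfunE.
- move=> y _; have [c ->] := line y; exists (mact X (DD i c)) => //.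
  exact: simple_at_actM.
Qed.

Section Gram.
Variable S : 'I_m -> lmodA T.
Hypothesis simS : forall i, simple_at i (S i).

Let D : 'M[int]_m := diag_mx (\row_i (vval Q i)%:Z).

Lemma euler_gram_simple i j :
  euler_gram T i j = (hom_dim (S i) (S j))%:Z - (ext_dim (S i) (S j))%:Z.
Proof.
rewrite -euler_gramP !(dimvec_simple_at (simS _)) /euler.
by rewrite trmx_delta -rowE -colE !mxE.
Qed.

Lemma hom_dim_simple i j : (hom_dim (S i) (S j))%:Z = (i == j)%:R * (vval Q i)%:Z.
Proof.
have [<-|ij] := eqVneq i j; first by rewrite mul1r (hom_dim_simple_at (simS i)).
by rewrite mul0r (hom_dim_simple_at_neq (simS i) (simS j) ij).
Qed.

(** The dimension vectors of the simples are the unit vectors, so they give the entries. Here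
    Ext^1(S_i, S_j) is measured over End(S_j), giving r_ji d_j; measured over End(S_i) it is d_i
    r'_ij, which gives the factorization of [euler_gram_Emx]. *)
Lemma euler_gram_Emx' : euler_gram T = (Emx' S)^T *m D.
Proof.
apply/matrixP => i j; rewrite mul_mx_diag euler_gram_simple hom_dim_simple !mxE.
rewrite (ext_ldim_dim _ (simple_at_End_division (simS j))).
rewrite (hom_dim_simple_at (simS j)) PoszM mulrBl eq_sym.
by have [->|_] := eqVneq j i; rewrite ?mul0r.
Qed.

Lemma euler_gram_Emx : euler_gram T = D *m Emx S.
Proof.
apply/matrixP => i j; rewrite mul_diag_mx euler_gram_simple hom_dim_simple !mxE.
rewrite (ext_rdim_dim _ (simple_at_End_division (simS i))).
rewrite (hom_dim_simple_at (simS i)) PoszM mulrBr mulrC.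
by congr (_ - _); rewrite mulrC.
Qed.

Lemma euler_rstar x y : euler T x y = ((rstar S x)^T *m D *m y) 0 0.
Proof. by rewrite /euler euler_gram_Emx' /rstar trmx_mul !mulmxA. Qed.

Lemma euler_lstar x y : euler T x y = (x^T *m D *m lstar S y) 0 0.
Proof. by rewrite /euler euler_gram_Emx /lstar !mulmxA. Qed.
End Gram.
End Simples.

(** * Submodules and quantum characters *)

Section Character.
Variables (k : finFieldType) (m : nat) (Q : vquiver m) (Sp : species k Q).
Variable (T : tensor_algebra Sp).
Implicit Types M N P I X Y : lmodA T.

Lemma submodule_limg N M (h : 'Hom(N, M)) (V : {vspace N}) :
  h \in homA N M -> submodule V -> submodule (h @: V)%VS.
Proof.
move=> /homAP hA /asboolP sV; apply/asboolP => a _ /memv_imgP[x xV ->].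
by rewrite -hA memv_img ?sV.
Qed.

Lemma submodule_lpreim N M (h : 'Hom(N, M)) (V : {vspace M}) :
  h \in homA N M -> submodule V -> submodule (h @^-1: V)%VS.
Proof.
move=> /homAP hA /asboolP sV; apply/asboolP => a x.
by rewrite -!memv_preim hA; apply: sV.
Qed.

Lemma submodule_cap M (U V : {vspace M}) :
  submodule U -> submodule V -> submodule (U :&: V)%VS.
Proof.
move=> /asboolP sU /asboolP sV; apply/asboolP => a x.
by rewrite !memv_cap => /andP[xU xV]; rewrite sU ?sV.
Qed.

Lemma submodule_lker N M (h : 'Hom(N, M)) : h \in homA N M -> submodule (lker h).
Proof.
move=> /homAP hA; apply/asboolP => a x.
by rewrite !memv_ker hA => /eqP->; rewrite linear0.
Qed.

(** Rank-nullity at each vertex, as h commutes with the idempotents. *)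
Lemma dimvec_sub_limg N M (h : 'Hom(N, M)) (V : {vspace N}) :
    h \in homA N M -> submodule V ->
  dimvec_sub V = dimvec_sub (h @: V)%VS + dimvec_sub (V :&: lker h)%VS.
Proof.
move=> hA sV; have sI := submodule_limg hA sV.
have sK := submodule_cap sV (submodule_lker hA).
apply/colP => i; rewrite [RHS]mxE.
have d0 : (vval Q i)%:Z != 0 by have := vval_gt0 Q i; lia.
apply: (mulIf d0); rewrite mulrDl -!dim_vertex_part //.
rewrite -(limg_ker_dim h (vertex_part V i)) PoszD addrC.
move/homAP: hA => hA; congr (_%:Z + _%:Z); congr (\dim _).
  by rewrite /vertex_part -!limg_comp; congr (_ @: _)%VS; apply/lfunP => x;
     rewrite !comp_lfunE hA.
apply/vspaceP => x; rewrite memv_cap.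
apply/andP/(vertex_partP _ _ sK).
  by case=> /(vertex_partP _ _ sV)[xV xE] xK; rewrite memv_cap xV.
rewrite memv_cap => -[/andP[xV xK] xE]; split=> //.
exact/(vertex_partP _ _ sV).
Qed.

Lemma dimvec_sub0 M : dimvec_sub (0%VS : {vspace M}) = 0.
Proof.
apply/colP => i; rewrite [RHS]mxE.
have d0 : (vval Q i)%:Z != 0 by have := vval_gt0 Q i; lia.
apply: (mulIf d0); rewrite mul0r -dim_vertex_part; last exact: submodule0.
by rewrite /vertex_part limg0 dimv0.
Qed.

Lemma dimvec_sub_inj N M (h : 'Hom(N, M)) (V : {vspace N}) :
    h \in homA N M -> lker h = 0%VS -> submodule V ->
  dimvec_sub (h @: V)%VS = dimvec_sub V.
Proof.
move=> hA h0 sV; rewrite (dimvec_sub_limg hA sV) h0.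
by rewrite capv0 dimvec_sub0 addr0.
Qed.

Lemma submodule_dimvec M (U : {vspace M}) : submodule U ->
  exists N (u : 'Hom(N, M)), [/\ u \in homA N M, lker u = 0%VS, limg u = U &
    dimvec N = dimvec_sub U].
Proof.
move=> /submodP[N [u [uA u0 uU]]]; exists N, u; split=> //.
by rewrite -uU dimvec_sub_inj //; apply: submodule_full.
Qed.

Lemma euler_projective P X : projective P ->
  euler T (dimvec P) (dimvec X) = (hom_dim P X)%:Z.
Proof. by move=> projP; rewrite euler_gramP ext_projective // subr0. Qed.

Lemma euler_injective X I : injective_mod I ->
  euler T (dimvec X) (dimvec I) = (hom_dim X I)%:Z.
Proof. by move=> injI; rewrite euler_gramP ext_injective // subr0. Qed.

Section QuantumCharacter.
Variables (S : 'I_m -> lmodA T) (L : 'M[int]_m).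

Definition qterm (i m_ p e : 'cV[int]_m) : qtorus k L :=
  vpow k (euler T (p - e) (m_ - e - i)) *:
    qX k L (rstar S (p - e) - lstar S (m_ - e - i)).

Lemma dimvec_sub_bounded M (U : {vspace M}) : submodule U ->
  exists e0 : 'cV['I_(\dim {:M}).+1]_m,
    dimvec_sub U = map_mx (fun t => (nat_of_ord t)%:Z) e0.
Proof.
move=> sU; exists (\col_i inord (absz (dimvec_sub U i 0))).
apply/colP => i; rewrite [RHS]mxE [X in nat_of_ord X]mxE.
have [r [rE _]] := vertex_part_basis i sU.
have := dim_vertex_part i sU; have := dimvS (subvf (vertex_part U i)).
have arith (d a b : nat) : (0 < d)%N -> (a <= b)%N -> a%:Z = r%:Z * d%:Z ->
  (r <= b)%N by rewrite -PoszM => d0 ab [aE]; nia.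
rewrite rE => leM dE; rewrite inordK // ltnS.
exact: arith (vval_gt0 Q i) leM dE.
Qed.

(** Each submodule of dimension vector e contributes once to the count |Gr_e M|, and by
    [dimvec_sub_bounded] the bounded index set misses none. *)
Lemma qcharE I M P : qchar S L I M P =
  \sum_(U : {vspace M} | submodule U)
    qterm (dimvec I) (dimvec M) (dimvec P) (dimvec_sub U).
Proof.
pose toZ (e0 : 'cV['I_(\dim {:M}).+1]_m) := map_mx (fun t => (nat_of_ord t)%:Z) e0.
have toZ_inj : injective toZ.
  move=> e e' /colP eE; apply/colP => i; have := eE i; rewrite !mxE.
  by move=> [/val_inj].
(* The bounded dimension vector of U, with the arbitrary value 0 when U is not a submodule; the sum
   is then partitioned along [h]. *)
have /choice[h hP] : forall U : {vspace M}, exists e0,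
    submodule U -> dimvec_sub U = toZ e0.
  move=> U; case: (boolP (submodule U)) => [/dimvec_sub_bounded[e0 e0E]|_].
    by exists e0.
  by exists (const_mx ord0).
have hE U e0 : submodule U -> (h U == e0) = (dimvec_sub U == toZ e0).
  by move=> /hP->; rewrite (inj_eq toZ_inj).
rewrite (partition_big h xpredT) //=; apply: eq_bigr => e0 _.
rewrite (eq_bigl (fun U => submodule U && (dimvec_sub U == toZ e0))); last first.
  by move=> U; case: (boolP (submodule U)) => //= sU; rewrite hE.
rewrite (eq_bigr (fun=> qterm (dimvec I) (dimvec M) (dimvec P) (toZ e0))); last first.
  by move=> U /andP[_ /eqP->].
rewrite sumr_const -scaler_nat /qterm scalerA /nb_sub cardsE.
by [].
Qed.
End QuantumCharacter.
End Character.

(** * The multiplication formulas *)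

Lemma lpreim_img (k : fieldType) (V W : vectType k) (h : 'Hom(V, W)) (U : {vspace V}) :
  (lker h <= U)%VS -> (h @^-1: (h @: U))%VS = U.
Proof.
move=> hU; apply/vspaceP => x; rewrite -memv_preim.
apply/memv_imgP/idP => [[y yU hxy]|xU]; last by exists x.
rewrite -[x](subrK y) rpredD // (subvP hU) // memv_ker linearB /= hxy.
by rewrite subrr.
Qed.

Section Bilinear.
Variables (m : nat) (L : 'M[int]_m).
Implicit Types a b : 'cV[int]_m.

Lemma lamNl a b : lam L (- a) b = - lam L a b.
Proof. by rewrite /lam (raddfN trmx) !mulNmx mxE. Qed.

Lemma lamNr a b : lam L a (- b) = - lam L a b.
Proof. by rewrite /lam mulmxN mxE. Qed.

Lemma lam_tr a b : lam L^T a b = lam L b a.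
Proof.
by rewrite /lam -[b^T *m L *m a]trmxK [RHS]mxE !trmx_mul trmxK mulmxA.
Qed.

Lemma lam_skew a b : L^T = - L -> lam L a b = - lam L b a.
Proof. by move=> skewL; rewrite -lam_tr skewL /lam mulmxN mulNmx mxE. Qed.

End Bilinear.

(** * Consequences of the one-dimensionality of Hom(P, M) and Hom(M, I) *)

Section HomFactor.
Variables (k : fieldType) (A : falgType k).
Implicit Types M N P I : lmodA A.

(** The map c |-> g c on End(P) is injective, since a nonzero c is invertible and g is nonzero; it
    is onto Hom(P, M) by equality of dimensions. *)
Lemma hom_rdim1_factor P M (g h : 'Hom(P, M)) : End_division P ->
    g \in homA P M -> g != 0 -> hom_rdim P M = 1%N -> h \in homA P M ->
  exists2 c, c \in homA P P & h = (g \o c)%VF.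
Proof.
move=> divP gA g0 dim1 hA.
have lE : linfun (fun c : 'End(P) => (g \o c)%VF) =1 (fun c => (g \o c)%VF).
  by apply: linfunE => a c d; rewrite comp_lfunDr -comp_lfunZr.
set phi := linfun _ in lE.
suff : (phi @: homA P P)%VS = homA P M.
  by move/vspaceP/(_ h); rewrite hA => /memv_imgP[c cA ->]; exists c; rewrite ?lE.
apply/eqP; rewrite eqEdim; apply/andP; split.
  by apply/subvP => _ /memv_imgP[c cA ->]; rewrite lE comp_homA.
rewrite limg_dim_eq.
  by rewrite -/(hom_dim P M) (hom_rdim_dim _ divP) dim1 mul1n.
apply/eqP; rewrite -subv0; apply/subvP => c.
rewrite memv_cap memv_ker memv0 lE => /andP[cA /eqP gc0].
apply: contraNT g0 => c0; have [d _ [_ cd]] := End_division_inv divP cA c0.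
by rewrite -[g]comp_lfun1r -cd comp_lfunA gc0 comp_lfun0l.
Qed.

Lemma hom_ldim1_factor M I (f h : 'Hom(M, I)) : End_division I ->
    f \in homA M I -> f != 0 -> hom_ldim M I = 1%N -> h \in homA M I ->
  exists2 c, c \in homA I I & h = (c \o f)%VF.
Proof.
move=> divI fA f0 dim1 hA.
have lE : linfun (fun c : 'End(I) => (c \o f)%VF) =1 (fun c => (c \o f)%VF).
  by apply: linfunE => a c d; rewrite comp_lfunDl -comp_lfunZl.
set phi := linfun _ in lE.
suff : (phi @: homA I I)%VS = homA M I.
  by move/vspaceP/(_ h); rewrite hA => /memv_imgP[c cA ->]; exists c; rewrite ?lE.
apply/eqP; rewrite eqEdim; apply/andP; split.
  by apply/subvP => _ /memv_imgP[c cA ->]; rewrite lE comp_homA.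
rewrite limg_dim_eq.
  by rewrite -/(hom_dim M I) (hom_ldim_dim _ divI) dim1 mul1n.
apply/eqP; rewrite -subv0; apply/subvP => c.
rewrite memv_cap memv_ker memv0 lE => /andP[cA /eqP cf0].
apply: contraNT f0 => c0; have [d _ [dc _]] := End_division_inv divI cA c0.
by rewrite -[f]comp_lfun1l -dc -comp_lfunA cf0 comp_lfun0r.
Qed.

Lemma hom_factor_sub P N M (u : 'Hom(N, M)) (h : 'Hom(P, M)) :
    u \in homA N M -> lker u = 0%VS -> h \in homA P M -> (limg h <= limg u)%VS ->
  exists2 h', h' \in homA P N & (u \o h')%VF = h.
Proof.
move=> /homAP uA u0 /homAP hA hu.
have uh x : u ((u^-1)%VF (h x)) = h x.
  by apply: limg_lfunVK; rewrite (subvP hu) // memv_img ?memvf.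
exists (u^-1 \o h)%VF; last by apply/lfunP => x; rewrite !comp_lfunE uh.
have inj_u : injective u by apply/lker0P/eqP.
by apply/homAP => a x; apply: inj_u; rewrite uA !comp_lfunE !uh hA.
Qed.

Section Dichotomy.
Variables (P M I N : lmodA A) (f : 'Hom(M, I)) (g : 'Hom(P, M)) (u : 'Hom(N, M)).
Hypotheses (injI : injective_mod I) (divI : End_division I) (divP : End_division P).
Hypotheses (fA : f \in homA M I) (f0 : f != 0) (dimMI : hom_ldim M I = 1%N).
Hypotheses (gA : g \in homA P M) (g0 : g != 0) (dimPM : hom_rdim P M = 1%N).
Hypotheses (uA : u \in homA N M) (u0 : lker u = 0%VS).

Lemma hom_dim_above : (limg g <= limg u)%VS -> hom_dim P N = hom_dim P P.
Proof.
move=> gu; rewrite -[RHS]mul1n -dimPM -(hom_rdim_dim _ divP).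
apply: (@dim_bij _ _ _ (fun h => (u \o h)%VF)).
- by move=> a c d; rewrite comp_lfunDr -comp_lfunZr.
- by move=> h; apply: comp_homA.
- move=> h _ uh; apply/lfunP => x; rewrite zero_lfunE; apply/eqP.
  by rewrite -memv0 -u0 memv_ker -comp_lfunE uh zero_lfunE.
move=> h hA; have [c cA hE] := hom_rdim1_factor divP gA g0 dimPM hA.
apply: hom_factor_sub => //; apply: subv_trans gu.
by rewrite hE limg_comp limgS ?subvf.
Qed.

(** A nonzero map into the submodule would be g c in M with c invertible, so Im g would lie in the
    submodule. *)
Lemma hom_dim_not_above : ~~ (limg g <= limg u)%VS -> hom_dim P N = 0%N.
Proof.
move=> gu; apply/eqP; rewrite dimv_eq0 -subv0; apply/subvP => h hA; rewrite memv0.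
apply: contraNT gu => h0.
have uhA := comp_homA uA hA.
have [c cA hE] := hom_rdim1_factor divP gA g0 dimPM uhA.
have c0 : c != 0.
  apply: contraNneq h0 => c0; apply/eqP/lfunP => x; rewrite zero_lfunE; apply/eqP.
  by rewrite -memv0 -u0 memv_ker -comp_lfunE hE c0 comp_lfun0r zero_lfunE.
have [d _ [_ cd]] := End_division_inv divP cA c0.
rewrite -[g]comp_lfun1r -cd comp_lfunA -hE -comp_lfunA limg_comp.
by rewrite limgS ?subvf.
Qed.

(** Every map from N to I extends to M by injectivity and so equals c f u for some c; hence Hom(N,
    I) vanishes exactly when f u does. *)
Lemma hom_dim_below : (hom_dim N I == 0%N) = (limg u <= lker f)%VS.
Proof.
have fuE : (limg u <= lker f)%VS = ((f \o u)%VF == 0).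
  apply/subvP/eqP => [uf|fu0 _ /memv_imgP[x _ ->]].
    apply/lfunP => x; rewrite comp_lfunE zero_lfunE; apply/eqP.
    by rewrite -memv_ker uf // memv_img ?memvf.
  by rewrite memv_ker -comp_lfunE fu0 zero_lfunE.
rewrite fuE dimv_eq0; apply/eqP/eqP => [N0|fu0].
  by apply/eqP; rewrite -memv0 -N0 comp_homA.
apply/eqP; rewrite -subv0; apply/subvP => h hA; rewrite memv0.
have [h' h'A <-] := injI uA u0 hA.
have [c cA ->] := hom_ldim1_factor divI fA f0 dimMI h'A.
by rewrite -comp_lfunA fu0 comp_lfun0r.
Qed.
End Dichotomy.
End HomFactor.

(** * The characters of the kernel and cokernel side as sums over submodules of M *)

Section Sums.
Variables (k : finFieldType) (m : nat) (Q : vquiver m) (Sp : species k Q).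
Variable (T : tensor_algebra Sp).
Variables (S : 'I_m -> lmodA T) (L : 'M[int]_m).
Implicit Types M N P I : lmodA T.
Local Notation O := (zero_lmodA T).
Local Notation qterm := (qterm S L).

Lemma zero_vspace (U : {vspace O}) : U = 0%VS.
Proof.
apply/eqP; rewrite -dimv_eq0 -leqn0.
by apply: leq_trans (dimvS (subvf U)) _; rewrite dimvf /dim /= muln0.
Qed.

Lemma dimvec_zero : dimvec O = 0.
Proof. by rewrite /dimvec (zero_vspace fullv) dimvec_sub0. Qed.

Lemma qchar_zero I P : qchar S L I O P = qterm (dimvec I) 0 (dimvec P) 0.
Proof.
rewrite qcharE dimvec_zero (big_pred1 0%VS).
  by rewrite dimvec_sub0.
by move=> U; rewrite (zero_vspace U) /= eqxx submodule0.
Qed.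

(** Submodules of G are those of M inside Ker f, with the same e. Exactness of 0 -> G -> M -> I ->
    I' -> 0 shows that the dimension vector of G minus that of I' equals m - i, so the terms
    agree. *)
Lemma qchar_ker M I I' G (f : 'Hom(M, I)) : f \in homA M I ->
    is_ker f G -> is_coker f I' ->
  qchar S L I' G O = \sum_(U : {vspace M} | submodule U && (U <= lker f)%VS)
    qterm (dimvec I) (dimvec M) 0 (dimvec_sub U).
Proof.
move=> fA [u [uA u0 uf]] [p [pA pfull pf]].
have sG := @submodule_full _ _ _ _ T G.
have dimG : dimvec G = dimvec_sub (lker f) by rewrite -uf dimvec_sub_inj.
have dimM : dimvec M = dimvec_sub (limg f) + dimvec_sub (lker f).
  by rewrite {1}/dimvec (dimvec_sub_limg fA (submodule_full M)) capfv.
have dimI : dimvec I = dimvec I' + dimvec_sub (limg f).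
  by rewrite {1}/dimvec (dimvec_sub_limg pA (submodule_full I)) capfv pfull pf.
rewrite qcharE dimvec_zero.
have uK V : (u @^-1: (u @: V))%VS = V by rewrite lpreim_img // u0 sub0v.
rewrite [RHS](reindex_onto (fun V : {vspace G} => (u @: V)%VS) (fun U => (u @^-1: U)%VS)).
  apply: eq_big => [V|V sV].
    rewrite uK eqxx andbT -uf limgS ?subvf // andbT.
    apply/idP/idP => [|sV]; first exact: submodule_limg.
    by rewrite -(uK V) submodule_lpreim.
  rewrite (dimvec_sub_inj uA u0 sV) /qterm.
  suff -> : dimvec G - dimvec_sub V - dimvec I' = dimvec M - dimvec_sub V - dimvec I by [].
  rewrite dimM dimI dimG; move: (dimvec_sub _) (dimvec_sub _) (dimvec_sub _) (dimvec _).
  by move=> a b c d; apply/colP => j; rewrite !mxE; ring.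
by move=> U /andP[_ Uf]; rewrite lpreimK // uf.
Qed.

Lemma qchar_coker P M P' F (g : 'Hom(P, M)) : g \in homA P M ->
    is_ker g P' -> is_coker g F ->
  qchar S L O F P' = \sum_(U : {vspace M} | submodule U && (limg g <= U)%VS)
    qterm 0 (dimvec M) (dimvec P) (dimvec_sub U).
Proof.
move=> gA [u [uA u0 ug]] [p [pA pfull pg]].
have dimP : dimvec P = dimvec_sub (limg g) + dimvec P'.
  rewrite {1}/dimvec (dimvec_sub_limg gA (submodule_full P)) capfv -ug.
  by rewrite (dimvec_sub_inj uA u0) // submodule_full.
have dimM : dimvec M = dimvec F + dimvec_sub (limg g).
  by rewrite {1}/dimvec (dimvec_sub_limg pA (submodule_full M)) capfv pfull pg.
rewrite qcharE dimvec_zero.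
have pK (V : {vspace F}) : (p @: (p @^-1: V))%VS = V by rewrite lpreimK // pfull subvf.
have kerp (V : {vspace F}) : (lker p <= p @^-1: V)%VS.
  by rewrite -lpreim0 lpreimS ?sub0v.
rewrite [RHS](reindex_onto (fun V : {vspace F} => (p @^-1: V)%VS) (fun U => (p @: U)%VS)).
  apply: eq_big => [V|V sV].
    rewrite pK eqxx andbT -pg kerp andbT.
    apply/idP/idP => [|sV]; first exact: submodule_lpreim.
    by rewrite -(pK V) submodule_limg.
  have -> : dimvec_sub (p @^-1: V)%VS = dimvec_sub V + dimvec_sub (limg g).
    rewrite (dimvec_sub_limg pA) ?submodule_lpreim // pK -pg.
    by rewrite (capv_idPr (kerp V)).
  rewrite dimP dimM /qterm.
  move: (dimvec_sub (limg g)) (dimvec_sub V) (dimvec F) (dimvec P') => a b c d.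
  have -> : a + d - (b + a) = d - b by apply/colP => j; rewrite !mxE; ring.
  by have -> : c + a - (b + a) = c - b by apply/colP => j; rewrite !mxE; ring.
by move=> U /andP[_ gU]; rewrite lpreim_img // pg.
Qed.
End Sums.

Section EulerBilinear.
Variables (k : finFieldType) (m : nat) (Q : vquiver m) (Sp : species k Q).
Variables (T : tensor_algebra Sp).
Implicit Types a b c : 'cV[int]_m.

Lemma eulerDl a b c : euler T (a + b) c = euler T a c + euler T b c.
Proof. exact: lamDl. Qed.

Lemma eulerDr a b c : euler T a (b + c) = euler T a b + euler T a c.
Proof. exact: lamDr. Qed.

Lemma eulerNl a b : euler T (- a) b = - euler T a b.
Proof. exact: lamNl. Qed.

Lemma eulerNr a b : euler T a (- b) = - euler T a b.
Proof. exact: lamNr. Qed.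
End EulerBilinear.

(** * Products in the quantum torus under the compatibility condition *)

Section CompatiblePair.
Variables (k : finFieldType) (m : nat) (Q : vquiver m) (Sp : species k Q).
Variables (T : tensor_algebra Sp) (S : 'I_m -> lmodA T) (L : 'M[int]_m).
Hypotheses (acyQ : acyclic Q) (simS : forall i, simple_at i (S i)).
Hypotheses (skewL : L^T = - L).
Hypothesis compL : L *m (- Bmx S) = diag_mx (\row_i (vval Q i)%:Z).
Local Notation D := (diag_mx (\row_i (vval Q i)%:Z)).
Local Notation rst := (rstar S).
Local Notation lst := (lstar S).

Lemma lam_Bmx x y : lam L x (Bmx S *m y) = - (x^T *m D *m y) 0 0.
Proof.
by rewrite -compL mulmxN mulmxN mulNmx [in RHS]mxE opprK /lam !mulmxA.
Qed.

Lemma lam_rstarl x y : lam L (rst x) (Bmx S *m y) = - euler T x y.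
Proof. by rewrite lam_Bmx (euler_rstar acyQ simS). Qed.

Lemma lstarE x : lst x = rst x - Bmx S *m x.
Proof.
by rewrite /lstar /rstar -mulmxBl /Bmx /Emx /Emx' opprB addrA subrK.
Qed.

Lemma rst_linear : [/\ {morph rst : x y / x + y} & {morph rst : x / - x}].
Proof. by split=> [x y|x]; rewrite /rstar ?mulmxDr ?mulmxN. Qed.

Lemma lst_linear : [/\ {morph lst : x y / x + y} & {morph lst : x / - x}].
Proof. by split=> [x y|x]; rewrite /lstar ?mulmxDr ?mulmxN. Qed.

Let rD := rst_linear.1. Let rN := rst_linear.2.
Let lD := lst_linear.1. Let lN := lst_linear.2.

(** In this form e occurs only behind B, where Lambda turns into the Euler form. *)
Lemma star_exponent dm e : rst (- e) - lst (dm - e) = - rst dm + Bmx S *m (dm - e).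
Proof.
rewrite lstarE rN rD rN mulmxBr; move: (rst _) (rst _) (_ *m _) (_ *m _) => a b c d.
by apply/colP => i; rewrite !mxE; ring.
Qed.

(** Pairing with the simple S_j gives d_j times the j-th coordinate of either side, and <p,s_j> =
    dim Hom(P, S_j) = dim Hom(S_j, I) = <s_j,i>. *)
Lemma nakayama_star (P I : lmodA T) : projective P -> injective_mod I ->
  isomorphic (nakayama P) I -> rst (dimvec P) = lst (dimvec I).
Proof.
move=> projP injI nuP; apply/colP => j.
have d0 : (vval Q j)%:Z != 0 by have := vval_gt0 Q j; lia.
have : euler T (dimvec P) (dimvec (S j)) = euler T (dimvec (S j)) (dimvec I).
  rewrite euler_projective // euler_injective // -(iso_hom_dim _ nuP).
  by rewrite nakayama_hom_dim.
rewrite (euler_rstar acyQ simS) (euler_lstar acyQ simS).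
rewrite (dimvec_simple_at acyQ (simS j)) -colE mul_mx_diag trmx_delta -mulmxA -rowE.
rewrite mul_diag_mx !mxE => /(etrans (mulrC _ _)); exact: mulfI.
Qed.

Section Products.
Variables p i : 'cV[int]_m.
Hypothesis pi_star : rst p = lst i.
Implicit Types dm e : 'cV[int]_m.

Lemma euler_pi x : euler T p x = euler T x i.
Proof.
rewrite (euler_rstar acyQ simS) (euler_lstar acyQ simS) -pi_star.
by rewrite -!/(lam D _ _) -[in LHS]tr_diag_mx lam_tr.
Qed.

(* Both sides of either formula are sums over the submodules of M; up to a    *)
(* power of v, the submodules of dimension vector e contribute this term.    *)
Definition middle_term dm e : qtorus k L :=
  vpow k (euler T (- e) (dm - e)) *: qX k L (rst (p - e) - lst (dm - e)).

Let vX_congr a a' b b' : a = a' -> b = b' ->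
  vpow k a *: qX k L b = vpow k a' *: qX k L b'.
Proof. by move=> -> ->. Qed.

Lemma qX_mul_qterm dm e : qX k L (rst p) * qterm S L 0 dm 0 e =
  vpow k (lam L (rst dm) (rst p)) *:
    (vpow k (- euler T p (dm - e)) *: middle_term dm e).
Proof.
rewrite /qterm /middle_term sub0r subr0 -scalerAr qX_mul !scalerA -!vpowD.
apply: vX_congr; last by rewrite rD addrA.
rewrite star_exponent lamDr lamNr lam_rstarl -(lam_skew _ _ skewL).
ring.
Qed.

(** Rewriting [lst i] as [rst p] against B contributes <m,i> - <e,i>, while expanding it as [rst i]
    - Bi against [rst dm] contributes -<m,i>; only -<e,i> survives. *)
Lemma qterm_mul_qX dm e : qterm S L 0 dm 0 e * qX k L (lst i) =
  vpow k (lam L (rst i) (rst dm)) *: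
    (vpow k (- euler T e i) *: middle_term dm e).
Proof.
rewrite /qterm /middle_term sub0r subr0 -scalerAl qX_mul !scalerA -!vpowD.
apply: vX_congr; last by rewrite rD -pi_star addrC addrA.
have B_i : lam L (Bmx S *m (dm - e)) (lst i) = euler T dm i - euler T e i.
  rewrite -pi_star (lam_skew _ _ skewL) lam_rstarl opprK euler_pi.
  by rewrite eulerDl eulerNl.
rewrite star_exponent lamDl B_i lamNl lstarE lamDr lamNr lam_rstarl.
rewrite (lam_skew (rst dm) _ skewL); ring.
Qed.

Lemma qterm_above dm e : euler T p (dm - e) = 0 -> qterm S L 0 dm p e = middle_term dm e.
Proof.
move=> e0; rewrite /qterm subr0; apply: vX_congr => //.
by rewrite eulerDl e0 add0r.
Qed.

Lemma qterm_below dm e : euler T e i = 0 -> qterm S L i dm 0 e = middle_term dm e.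
Proof.
move=> e0; rewrite /qterm sub0r; apply: vX_congr.
  by rewrite [LHS]eulerDr eulerNr [euler T (- e) i]eulerNl e0 !oppr0 addr0.
rewrite [in LHS]lD lN rD -pi_star.
move: (rst (- e)) (lst (dm - e)) (rst p) => a b c.
by apply/colP => j; rewrite !mxE; ring.
Qed.
End Products.
End CompatiblePair.

(** * Splitting the submodules of M and assembling the two formulas *)

Section Main.
Variables (k : finFieldType) (m : nat) (Q : vquiver m) (acyQ : acyclic Q).
Variables (Sp : species k Q) (T : tensor_algebra Sp).
Variables (S : 'I_m -> lmodA T) (simS : forall i, simple_at i (S i)).
Variables (L : 'M[int]_m) (skewL : L^T = - L).
Variable compL : L *m (- Bmx S) = diag_mx (\row_i (vval Q i)%:Z).
Variables (M I P : lmodA T) (injI : injective_mod I) (projP : projective P).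
Variable nuP : isomorphic (nakayama P) I.
Variables (divI : End_division I) (divP : End_division P).
Variables (f : 'Hom(M, I)) (homf : f \in homA M I) (f_neq0 : f != 0).
Variables (g : 'Hom(P, M)) (homg : g \in homA P M) (g_neq0 : g != 0).
Variables (dimMI : hom_ldim M I = 1%N) (dimPM : hom_rdim P M = 1%N).
Local Notation O := (zero_lmodA T).
Local Notation dm := (dimvec M).
Local Notation i := (dimvec I).
Local Notation p := (dimvec P).
Local Notation d := (hom_dim P P)%:Z.

Let pi_star : rstar S p = lstar S i.
Proof. exact: (nakayama_star acyQ simS projP injI nuP). Qed.

Lemma hom_dim_nakayama N : hom_dim P N = hom_dim N I.
Proof. by rewrite -nakayama_hom_dim // (iso_hom_dim _ nuP). Qed.

(** The number <p,e> = dim Hom(P,U) = dim Hom(U,I) is d or 0 according to whether Im g lies in U,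
    and it vanishes exactly when U lies in Ker f; d is nonzero because g is. *)
Lemma submodule_dichotomy (U : {vspace M}) : submodule U ->
  (~~ (limg g <= U)%VS = (U <= lker f)%VS) /\
  euler T p (dimvec_sub U) = if (limg g <= U)%VS then d else 0.
Proof.
move=> /submodule_dimvec[N [u [uA u0 uU <-]]]; rewrite -uU.
have d0 : hom_dim P P != 0%N.
  rewrite dimv_eq0; apply/negP => /eqP P0.
  have := id_homA P; rewrite P0 memv0 => /eqP id0; case/negP: g_neq0.
  by rewrite -[g]comp_lfun1r id0 comp_lfun0r.
rewrite euler_projective // -(hom_dim_below injI divI homf f_neq0 dimMI uA u0).
rewrite -hom_dim_nakayama; case: ifPn => gu.
  by rewrite (hom_dim_above divP homg g_neq0 dimPM uA u0 gu) (negbTE d0).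
by rewrite (hom_dim_not_above divP homg g_neq0 dimPM uA u0 gu) eqxx.
Qed.

Lemma euler_pm : euler T p dm = d.
Proof. by rewrite euler_projective // (hom_rdim_dim _ divP) dimPM mul1n. Qed.

(** Both one-dimensionality assumptions enter: dim End(P) = dim Hom(P,M) = dim Hom(M,I) = dim
    End(I). *)
Lemma euler_ii : euler T i i = d.
Proof.
rewrite -euler_pm (euler_injective _ injI) (euler_projective _ projP).
by rewrite hom_dim_nakayama (hom_ldim_dim M divI) dimMI mul1n.
Qed.

Lemma qchar_shift_projective : qchar S L O O P = qX k L (rstar S p).
Proof.
rewrite qchar_zero dimvec_zero /qterm !subr0 /euler mulmx0 mxE vpow0 scale1r.
by rewrite /lstar mulmx0 subr0.
Qed.

Lemma qchar_shift_injective : qchar S L I O O = qX k L (lstar S i).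
Proof.
rewrite qchar_zero dimvec_zero /qterm !subr0 /euler trmx0 !mul0mx mxE vpow0.
by rewrite scale1r /rstar /lstar mulmx0 !sub0r mulmxN opprK.
Qed.

Lemma sum_submodule_split (F : 'cV[int]_m -> qtorus k L) :
   \sum_(U : {vspace M} | submodule U) F (dimvec_sub U) =
   \sum_(U : {vspace M} | submodule U && (limg g <= U)%VS) F (dimvec_sub U) +
   \sum_(U : {vspace M} | submodule U && (U <= lker f)%VS) F (dimvec_sub U).
Proof.
rewrite (bigID (fun U : {vspace M} => (limg g <= U)%VS)) /=; congr (_ + _).
apply: eq_bigl => U; case: (boolP (submodule U)) => //= sU.
by have [-> _] := submodule_dichotomy sU.
Qed.

Variables (G I' P' F : lmodA T).
Hypotheses (kerG : is_ker f G) (cokerI' : is_coker f I').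
Hypotheses (kerP' : is_ker g P') (cokerF : is_coker g F).

Let euler_above (U : {vspace M}) : submodule U -> (limg g <= U)%VS ->
  euler T p (dimvec_sub U) = d.
Proof. by move=> /submodule_dichotomy[_ ->] ->. Qed.

Let euler_below (U : {vspace M}) : submodule U -> (U <= lker f)%VS ->
  euler T p (dimvec_sub U) = 0.
Proof. by move=> /submodule_dichotomy[<- ->] /negbTE->. Qed.

Lemma qchar_F : qchar S L O F P' =
  \sum_(U : {vspace M} | submodule U && (limg g <= U)%VS)
    middle_term S L p dm (dimvec_sub U).
Proof.
rewrite (qchar_coker S L homg kerP' cokerF); apply: eq_bigr => U /andP[sU gU].
by apply: qterm_above; rewrite eulerDr eulerNr euler_pm (euler_above sU gU) subrr.
Qed.

Lemma qchar_G : qchar S L I' G O =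
  \sum_(U : {vspace M} | submodule U && (U <= lker f)%VS)
    middle_term S L p dm (dimvec_sub U).
Proof.
rewrite (qchar_ker S L homf kerG cokerI'); apply: eq_bigr => U /andP[sU fU].
by apply: (qterm_below L pi_star); rewrite -(euler_pi acyQ simS pi_star) euler_below.
Qed.

Lemma qchar_P_mul_M : qchar S L O O P * qchar S L O M O =
  vpow k (lam L (rstar S dm) (rstar S p)) *:
    (qchar S L O F P' + vpow k (- euler T i i) *: qchar S L I' G O).
Proof.
rewrite qchar_shift_projective qcharE dimvec_zero mulr_sumr.
under eq_bigr do rewrite (qX_mul_qterm acyQ simS skewL compL).
rewrite -scaler_sumr; apply: (f_equal ( *:%R _)).
rewrite (sum_submodule_split
  (fun e => vpow k (- euler T p (dm - e)) *: middle_term S L p dm e)).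
rewrite qchar_F qchar_G euler_ii scaler_sumr; apply: (f_equal2 +%R).
  apply: eq_bigr => U /andP[sU gU].
  by rewrite eulerDr eulerNr euler_pm (euler_above sU gU) subrr oppr0 vpow0 scale1r.
apply: eq_bigr => U /andP[sU fU].
by rewrite eulerDr eulerNr euler_pm (euler_below sU fU) oppr0 addr0.
Qed.

Lemma qchar_M_mul_I : qchar S L O M O * qchar S L I O O =
  vpow k (lam L (rstar S i) (rstar S dm)) *:
    (vpow k (- euler T p p) *: qchar S L O F P' + qchar S L I' G O).
Proof.
rewrite qchar_shift_injective qcharE dimvec_zero mulr_suml.
under eq_bigr do rewrite (qterm_mul_qX acyQ simS skewL compL pi_star).
rewrite -scaler_sumr; apply: (f_equal ( *:%R _)).
rewrite (sum_submodule_split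
  (fun e => vpow k (- euler T e i) *: middle_term S L p dm e)).
rewrite qchar_F qchar_G (euler_projective P projP) scaler_sumr; apply: (f_equal2 +%R).
  apply: eq_bigr => U /andP[sU gU].
  by rewrite -(euler_pi acyQ simS pi_star) (euler_above sU gU).
apply: eq_bigr => U /andP[sU fU].
by rewrite -(euler_pi acyQ simS pi_star) (euler_below sU fU) oppr0 vpow0 scale1r.
Qed.
End Main.

Theorem corollary5p8 (k : finFieldType) (n m : nat) (le_nm : (n <= m)%N)
  (Q : vquiver n) (Qt : vquiver m)
  (acyQ : acyclic Q) (attQt : attaches_vertices le_nm Q Qt)
  (acyQt : acyclic Qt)
  (Sp : species k Qt) (T : tensor_algebra Sp)
  (S : 'I_m -> lmodA T) (simS : forall i, simple_at i (S i))
  (L : 'M[int]_m) (skewL : L^T = - L)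
  (compL : L *m (- Bmx S) = diag_mx (\row_i (vval Qt i)%:Z))
  (M I P : lmodA T) (injI : injective_mod I)
  (projP : projective P) (nuP : isomorphic (nakayama P) I)
  (divI : End_division I) (divP : End_division P)
  (f : 'Hom(M, I)) (homf : f \in homA M I) (f_neq0 : f != 0)
  (g : 'Hom(P, M)) (homg : g \in homA P M) (g_neq0 : g != 0)
  (dimMI : hom_ldim M I = 1%N) (dimPM : hom_rdim P M = 1%N)
  (G I' P' F : lmodA T)
  (kerG : is_ker f G) (cokerI' : is_coker f I')
  (kerP' : is_ker g P') (cokerF : is_coker g F) :
  let O := zero_lmodA T in
  let X := qchar S L in
  let m_ := dimvec M in let i_ := dimvec I in let p_ := dimvec P in
  X O O P * X O M O =
    vpow k (lam L (rstar S m_) (rstar S p_)) *: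
      (X O F P' + vpow k (- euler T i_ i_) *: X I' G O)
  /\
  X O M O * X I O O =
    vpow k (lam L (rstar S i_) (rstar S m_)) *:
      (vpow k (- euler T p_ p_) *: X O F P' + X I' G O).
Proof.
move=> O X m_ i_ p_; split.
- exact: (qchar_P_mul_M acyQt simS skewL compL injI projP nuP divI divP
    homf f_neq0 homg g_neq0 dimMI dimPM kerG cokerI' kerP' cokerF).
- exact: (qchar_M_mul_I acyQt simS skewL compL injI projP nuP divI divP
    homf f_neq0 homg g_neq0 dimMI dimPM kerG cokerI' kerP' cokerF).
Qed.
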